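(* Let $\{\zeta_t,t\in\mathbb Z\}$ be i.i.d. with $E\zeta_0=0$, $E\zeta_0^2=1$, $E|\zeta_0|^3<\infty$ and $\mu_3=E\zeta_0^3=0$. Let $a\in\mathbb R$, $c\ge0$ and real $b_j$, $j\ge1$, with $B^2:=\sum_{j\ge1}b_j^2<1/5$. Let $\{r_t\}$ be a stationary $L^2$-solution of $$r_t=\zeta_t\sigma_t,\qquad \sigma_t=\sqrt{c^2+\Big(a+\sum_{s<t}b_{t-s}r_s\Big)^2},\quad t\in\mathbb Z,$$ with $E|r_0|^3<\infty$, and let $h_j:=\mathrm{Cov}(\sigma_t^2,r_{t-j})$, $j\ge1$. Then for any fixed $k$ with $1\le k\le\infty$: (i) if $ab_1<0$ and $ab_j\le0$ for $j=2,\dots,k$, then $h_j<0$ for all $1\le j\le k$; (ii) if $ab_1>0$ and $ab_j\ge0$ for $j=2,\dots,k$, then $h_j>0$ for all $1\le j\le k$. (For $k=\infty$, $j$ ranges over all positive integers.)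
   Context: $\mathcal F_t:=\sigma(\zeta_s,s\le t)$; a process is adapted if $r_t$ is $\mathcal F_t$-measurable for each $t$. An $L^2$-solution of the displayed equation is an adapted process $\{r_t\}$ with $Er_t^2<\infty$ such that for every $t$ the series $\sum_{s<t}b_{t-s}r_s$ converges in $L^2$ and the equation holds. By stationarity $h_j$ does not depend on $t$. *)

(* Defs.v *)
From HB Require Import structures.
From mathcomp Require Import all_boot all_order all_algebra.
From mathcomp Require Import all_classical all_reals all_analysis.
Set Implicit Arguments. Unset Strict Implicit. Unset Printing Implicit Defensive.
Import Order.TTheory GRing.Theory Num.Theory.
Import numFieldNormedType.Exports.
Local Open Scope classical_set_scope.
Local Open Scope ring_scope.

(* Processes indexed by t : int on a
   probability space P over T; real-valued random variables are plain
   functions T -> R with explicit measurability. *)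

Section defs.
Context {d : measure_display} {T : measurableType d} {R : realType}
  (P : probability T R).

Definition mutually_independent (X : int -> T -> R) : Prop :=
  forall (s : seq int) (A : int -> set R), uniq s ->
    (forall i, measurable (A i)) ->
    P (\big[setI/setT]_(i <- s) (X i @^-1` A i)) =
    (\prod_(i <- s) P (X i @^-1` A i))%E.

Definition identically_distributed (X : int -> T -> R) : Prop :=
  forall t (A : set R), measurable A -> P (X t @^-1` A) = P (X 0 @^-1` A).

Definition strictly_stationary (X : int -> T -> R) : Prop :=
  forall (s : seq int) (A : int -> set R) (tau : int),
    (forall i, measurable (A i)) ->
    P (\big[setI/setT]_(i <- s) (X (i + tau) @^-1` A i)) =
    P (\big[setI/setT]_(i <- s) (X i @^-1` A i)).

End defs.

Definition past_gen {T : Type} {R : realType} (zeta : int -> T -> R) (t : int)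
  : set (set T) :=
  [set E | exists s : int, (s <= t)%R /\
     exists B : set R, measurable B /\ E = zeta s @^-1` B].

Definition adapted {T : Type} {R : realType} (zeta r : int -> T -> R) : Prop :=
  forall (t : int) (B : set R), measurable B ->
    <<s past_gen zeta t >> (r t @^-1` B).

Definition psum {T : Type} {R : realType} (b : nat -> R) (r : int -> T -> R)
  (t : int) (n : nat) (x : T) : R :=
  \sum_(1 <= j < n.+1) b j * r (t - (j%:Z))%R x.

(* sigma_t built from the L^2 limit S_t of the series *)
Definition sigma_of {T : Type} {R : realType} (a c : R) (S : int -> T -> R)
  (t : int) (x : T) : R :=
  Num.sqrt (c ^+ 2 + (a + S t x) ^+ 2).

Definition upto (k : option nat) (j : nat) : bool :=
  match k with Some n => (j <= n)%N | None => true end.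

(* Main.v *)
Require Import Defs.
From HB Require Import structures.
From mathcomp Require Import all_boot all_order all_algebra.
From mathcomp Require Import all_classical all_reals all_analysis.
From mathcomp Require Import measurable_realfun.
From mathcomp Require Import ring lra.
Import Order.TTheory GRing.Theory Num.Theory.
Import numFieldNormedType.Exports.
Local Open Scope classical_set_scope.
Local Open Scope ring_scope.

(**
  Write h_j = E[r_t^2 r_(t-j)], which equals Cov(sigma_t^2, r_(t-j)) because
  zeta_t is independent of the past, and m = E r_0^2.  Splitting
  S_t = (terms after t-j) + b_j r_(t-j) + X_j, where X_j is the tail of the
  series, and using E zeta = E zeta^3 = 0, all cubic moments whose latest factor
  has odd multiplicity vanish, which leaves
    h_j = 2 b_j (a m + D_j) + sum_(1 <= i < j) b_i^2 h_(j-i),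
    D_j = E[r_(t-j)^2 X_j] = sum_(i > j) b_i h_(i-j).
  The D_j are bounded, since E|X_j|^3 <= E|S_t|^3 by convexity.  If
  |D_j| <= delta for all j, the recursion bounds the l^2 norm of h, and
  Cauchy-Schwarz for D_j returns |D_j| <= 2 B^2 (|a| m + delta) / (1 - B^2); for
  B^2 < 1/5 the least such delta is smaller than |a| m.  Hence a m + D_j has the
  sign of a, and the signs of the h_j follow by induction on the recursion.
*)

(** * Independence *)

(** Third moments are all that is available, and this shapes the proof. The weight r_(t-j)^2 lies
    only in L^(3/2), so L^2 convergence of the series does not by itself let the expectation in D_j
    pass through the sum. A uniform L^3 bound on the tails repairs this: with it, L^2 convergence
    becomes weak convergence against squares of L^3 variables. The bound requires S_t in L^3, which
    is not assumed; it follows from E|r_t|^3 = E|zeta_t|^3 E|sigma_t|^3, where the first factor on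
    the right is positive and finite. A second obstacle is that S_t, as an L^2 limit, is fixed only
    up to null sets and need not be measurable for the past. Independence is therefore applied to
    versions that are. *)

Section independent_pair.
Context {d dX dY : measure_display} {T : measurableType d}
  {X : measurableType dX} {Y : measurableType dY} {R : realType}.
Variables (P : probability T R) (Z : T -> X) (W : T -> Y).
Hypothesis mZ : measurable_fun setT Z.
Hypothesis mW : measurable_fun setT W.
Hypothesis indepZW : forall A B, measurable A -> measurable B ->
  P (Z @^-1` A `&` W @^-1` B) = (P (Z @^-1` A) * P (W @^-1` B))%E.

Let Zm : {mfun T >-> X} := HB.pack Z (isMeasurableFun.Build _ _ _ _ _ mZ).
Let Wm : {mfun T >-> Y} := HB.pack W (isMeasurableFun.Build _ _ _ _ _ mW).
Let mZW : measurable_fun setT (fun x => (Z x, W x)).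
Proof. exact/measurable_fun_pair. Qed.
Let ZWm : {mfun T >-> (X * Y)%type} :=
  HB.pack (fun x => (Z x, W x)) (isMeasurableFun.Build _ _ _ _ _ mZW).

Let distributionZW A : measurable A ->
  (distribution P Zm \x distribution P Wm)%E A = distribution P ZWm A.
Proof. by apply: product_measure_unique => B C mB mC; exact: indepZW. Qed.

(** The target spaces stay abstract because [W] will later be the identity of [T], seen as a map
    into [T] with the sigma-algebra of the past. Independence of a variable and a sigma-algebra is
    then a case of independence of two variables. *)
Lemma ge0_integral_indepM (f : X -> R) (g : Y -> R) :
  measurable_fun setT f -> measurable_fun setT g ->
  (forall x, 0 <= f x) -> (forall y, 0 <= g y) ->
  (\int[P]_x (f (Z x) * g (W x))%:E =
   \int[P]_x (f (Z x))%:E * \int[P]_x (g (W x))%:E)%E.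
Proof.
move=> mf mg f0 g0.
have mfg : @measurable_fun _ _ _ (\bar R) [set: X * Y]
    (fun z => (f z.1 * g z.2)%:E).
  apply/measurable_EFinP; apply: measurable_funM.
    exact: measurableT_comp mf measurable_fst.
  exact: measurableT_comp mg measurable_snd.
have <- : (\int[distribution P ZWm]_z (f z.1 * g z.2)%:E =
          \int[P]_x (f (Z x) * g (W x))%:E)%E.
  by rewrite ge0_integral_distribution// => z; rewrite lee_fin mulr_ge0.
rewrite (eq_measure_integral (distribution P Zm \x distribution P Wm)%E);
  last by move=> A mA _; exact/esym/distributionZW.
rewrite fubini_tonelli1//; last by move=> z; rewrite lee_fin mulr_ge0.
rewrite /fubini_F /=.
under eq_integral => x _.
  under eq_integral do rewrite EFinM.
  rewrite ge0_integralZl//; [|by apply/measurable_EFinP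
    |by move=> y _; rewrite lee_fin|by rewrite lee_fin].
  over.
rewrite ge0_integralZr//; [|by apply/measurable_EFinP
  |by move=> y _; rewrite lee_fin|by apply: integral_ge0 => y _; rewrite lee_fin].
congr (_ * _)%E.
  by rewrite ge0_integral_distribution//; apply/measurable_EFinP.
by rewrite ge0_integral_distribution//; apply/measurable_EFinP.
Qed.

Lemma integrable_indepM (f : X -> R) (g : Y -> R) :
  measurable_fun setT f -> measurable_fun setT g ->
  P.-integrable setT (fun x => (f (Z x))%:E) ->
  P.-integrable setT (fun x => (g (W x))%:E) ->
  P.-integrable setT (fun x => (f (Z x) * g (W x))%:E).
Proof.
move=> mf mg /integrableP[_ fZ] /integrableP[_ gW]; apply/integrableP; split.
  by apply/measurable_EFinP; apply: measurable_funM; apply: measurableT_comp.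
under eq_integral do rewrite abse_EFin normrM.
rewrite (ge0_integral_indepM (fun x => `|f x|) (fun x => `|g x|))//;
  [|exact: measurableT_comp..].
by rewrite lte_mul_pinfty// ?ge0_fin_numE// integral_ge0.
Qed.

Lemma Rintegral_indepM (f : X -> R) (g : Y -> R) :
  measurable_fun setT f -> measurable_fun setT g ->
  P.-integrable setT (fun x => (f (Z x))%:E) ->
  P.-integrable setT (fun x => (g (W x))%:E) ->
  \int[P]_x (f (Z x) * g (W x)) = (\int[P]_x f (Z x)) * (\int[P]_x g (W x)).
Proof.
move=> mf mg fZ gW.
have fg := integrable_indepM f g mf mg fZ gW.
have mfg : @measurable_fun _ _ _ (\bar R) [set: X * Y]
    (fun z => (f z.1 * g z.2)%:E).
  apply/measurable_EFinP; apply: measurable_funM.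
    exact: measurableT_comp mf measurable_fst.
  exact: measurableT_comp mg measurable_snd.
have fgD : (distribution P ZWm).-integrable setT (fun z => (f z.1 * g z.2)%:E).
  exact: integrable_pushforward.
have fgX : (distribution P Zm \x distribution P Wm)%E.-integrable setT
    (fun z => (f z.1 * g z.2)%:E).
  apply/integrableP; split=> //.
  rewrite (eq_measure_integral (distribution P ZWm)); last first.
    by move=> A mA _; exact: distributionZW.
  by case/integrableP : fgD.
have gD : (distribution P Wm).-integrable setT (EFin \o g).
  by apply: integrable_pushforward => //; exact/measurable_EFinP.
have fD : (distribution P Zm).-integrable setT (EFin \o f).
  by apply: integrable_pushforward => //; exact/measurable_EFinP.
rewrite /Rintegral -fineM; [|exact: integrable_fin_num..].
congr fine.
have <- : (\int[distribution P ZWm]_z (f z.1 * g z.2)%:E =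
          \int[P]_x (f (Z x) * g (W x))%:E)%E by rewrite integral_distribution.
rewrite (eq_measure_integral (distribution P Zm \x distribution P Wm)%E);
  last by move=> A mA _; exact/esym/distributionZW.
rewrite -integral12_prod_meas1// /fubini_F /=.
under eq_integral => x _.
  under eq_integral do rewrite EFinM.
  rewrite integralZl//.
  over.
have EW : (\int[distribution P Wm]_y (g y)%:E = \int[P]_x (g (W x))%:E)%E.
  by rewrite integral_distribution//; exact/measurable_EFinP.
rewrite EW; have := integrable_fin_num measurableT gW.
move: (\int[P]_x _)%E => [q| |]// _; rewrite integralZr//.
by rewrite integral_distribution//; exact/measurable_EFinP.
Qed.

End independent_pair.

Section past.
Context {d : measure_display} {T : measurableType d} {R : realType}.
Variables (P : probability T R) (zeta : int -> T -> R).
Hypothesis mzeta : forall t, measurable_fun setT (zeta t).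

Lemma sub_past_gen s t : s <= t -> past_gen zeta s `<=` past_gen zeta t.
Proof.
move=> st E [u [us BE]]; exists u; split => //; exact: le_trans us st.
Qed.

Lemma past_measurable t : <<s past_gen zeta t >> `<=` measurable.
Proof.
apply: smallest_sub; first exact: sigma_algebra_measurable.
by move=> _ [s [_ [B [mB ->]]]]; rewrite -[X in measurable X]setTI; exact: mzeta.
Qed.

(** Uniqueness of measures on a pi-system: the finite cylinders [G] over times before t generate the
    past, and on them B |-> P(A and B) agrees with the multiple P(A) P. *)
Lemma indep_past (t : int) : mutually_independent P zeta ->
  forall A B, measurable A -> <<s past_gen zeta (t - 1) >> B ->
  P (zeta t @^-1` A `&` B) = (P (zeta t @^-1` A) * P B)%E.
Proof.
move=> ind A B mA.
pose G := [set E | exists (s : seq int) (C : int -> set R),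
  [/\ uniq s, all (fun i => i <= t - 1) s, (forall i, measurable (C i)) &
      E = \big[setI/setT]_(i <- s) (zeta i @^-1` C i)]].
have GT : G setT by exists [::], (fun=> setT); rewrite big_nil.
have mzA : measurable (zeta t @^-1` A).
  by rewrite -[X in measurable X]setTI; exact: mzeta.
have Gm : G `<=` measurable.
  move=> _ [s [C [_ _ mC ->]]]; apply: bigsetI_measurable => i _.
  by rewrite -[X in measurable X]setTI; exact: mzeta.
have GI : setI_closed G.
  move=> _ _ [s1 [C1 [_ s1t mC1 ->]]] [s2 [C2 [_ s2t mC2 ->]]].
  (* The two time lists may overlap while independence asks for distinct times, hence [undup]; a
     time absent from one list carries the trivial constraint [setT] there. *)
  exists (undup (s1 ++ s2)), (fun i => (if i \in s1 then C1 i else setT) `&`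
    (if i \in s2 then C2 i else setT)); split.
  - exact: undup_uniq.
  - apply/allP => i; rewrite mem_undup mem_cat => /orP[] iS.
      exact: (allP s1t).
    exact: (allP s2t).
  - by move=> i; apply: measurableI; case: ifP.
  - rewrite -!bigcap_seq; apply/seteqP; split => [x [H1 H2] i /= _|x H].
      by split; case: ifPn => // iS; [exact: H1|exact: H2].
    split=> i /= iS; have /= := H i; rewrite mem_undup mem_cat iS ?orbT.
      by move=> /(_ isT) [].
    by move=> /(_ isT) [].
have sG : <<s past_gen zeta (t - 1) >> `<=` <<s G >>.
  apply: sub_sigma_algebra2 => _ [s [st [C [mC ->]]]].
  exists [:: s], (fun=> C); split => //=; first by rewrite st.
  by rewrite big_seq1.
move=> /sG sB.
have PA0 : 0 <= fine (P (zeta t @^-1` A)) by rewrite fine_ge0.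
have fA : P (zeta t @^-1` A) \is a fin_num by rewrite fin_num_measure.
rewrite setIC -(fineK fA).
apply: (g_sigma_algebra_measure_unique G Gm (fun=> setT) _ _
  (mrestr P mzA) (mscale (NngNum PA0) P)) sB => //.
- by rewrite bigcup_const.
- move=> _ [s [C [us st mC ->]]].
  transitivity (P (\big[setI/setT]_(i <- s) (zeta i @^-1` C i)) *
    P (zeta t @^-1` A))%E; last by rewrite muleC -[in LHS](fineK fA).
  rewrite -[LHS]/(P (_ `&` _)).
  pose C' i := if i == t then A else C i.
  have tS : t \notin s.
    by apply/negP => /(allP st) /=; rewrite lerBrDr gerDl ler10.
  have C'E i : i \in s -> C' i = C i.
    by rewrite /C'; case: eqP => // -> tIn; rewrite tIn in tS.
  have mC' i : measurable (C' i) by rewrite /C'; case: ifP.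
  have us' : uniq (t :: s) by rewrite /= tS us.
  have := ind (t :: s) C' us' mC'.
  rewrite !big_cons {1 3}/C' eqxx.
  rewrite (eq_big_seq (fun i => zeta i @^-1` C i)); last first.
    by move=> i /C'E ->.
  rewrite setIC => ->; rewrite muleC; congr (_ * _)%E; apply/esym.
  rewrite (eq_big_seq (fun i => P (zeta i @^-1` C i))); last first.
    by move=> i /C'E ->.
  by rewrite -ind.
- by move=> k; rewrite /= /mrestr setTI ltey_eq fin_num_measure.
Qed.

End past.

(** * Stationarity and almost sure measurability with respect to the past *)

Section identical_pairs.
Context {d dX dY : measure_display} {T : measurableType d}
  {X : measurableType dX} {Y : measurableType dY} {R : realType}.
Variables (P : probability T R) (Z Z' : T -> X) (W W' : T -> Y).
Hypotheses (mZ : measurable_fun setT Z) (mZ' : measurable_fun setT Z').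
Hypotheses (mW : measurable_fun setT W) (mW' : measurable_fun setT W').
Hypothesis eqZW : forall A B, measurable A -> measurable B ->
  P (Z @^-1` A `&` W @^-1` B) = P (Z' @^-1` A `&` W' @^-1` B).

Let ZWm : {mfun T >-> (X * Y)%type} := HB.pack (fun x => (Z x, W x))
  (isMeasurableFun.Build _ _ _ _ _ (measurable_fun_pair mZ mW)).
Let ZWm' : {mfun T >-> (X * Y)%type} := HB.pack (fun x => (Z' x, W' x))
  (isMeasurableFun.Build _ _ _ _ _ (measurable_fun_pair mZ' mW')).

Let distribution_eq A : measurable A ->
  distribution P ZWm A = distribution P ZWm' A.
Proof.
pose C : set (set (X * Y)) := [set A `*` B | A in measurable & B in measurable].
apply: (measure_unique C (fun=> setT)).
- by rewrite measurable_prod_measurableType.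
- move=> _ _ [A1 mA1 [B1 mB1 <-]] [A2 mA2 [B2 mB2 <-]].
  rewrite -setXI; exists (A1 `&` A2); first exact: measurableI.
  by exists (B1 `&` B2) => //; exact: measurableI.
- by move=> _; exists setT => //; exists setT => //; rewrite setXTT.
- by rewrite bigcup_const.
- by move=> _ [A1 mA1 [B1 mB1 <-]]; exact: eqZW.
- move=> k; rewrite -[X in (X < _)%E]/(distribution P ZWm setT).
  by rewrite probability_setT ltry.
Qed.

(** Positive and negative parts are transferred separately, so infinite integrals are covered. This
    is what later carries integrability itself from time 0 to time t. *)
Lemma integral_eq_distribution (f : X * Y -> \bar R) : measurable_fun setT f ->
  (\int[P]_x f (Z x, W x) = \int[P]_x f (Z' x, W' x))%E.
Proof.
move=> mf.
have E (g : X * Y -> \bar R) : measurable_fun setT g ->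
    (forall z, 0 <= g z)%E ->
    (\int[P]_x g (Z x, W x) = \int[P]_x g (Z' x, W' x))%E.
  move=> mg g0; transitivity (\int[distribution P ZWm]_z g z)%E.
    by rewrite ge0_integral_distribution.
  rewrite (eq_measure_integral (distribution P ZWm')).
    by rewrite ge0_integral_distribution.
  by move=> A mA _; exact: distribution_eq.
have posE (V : T -> X * Y) :
    (\int[P]_x (fun y => f (V y))^\+ x = \int[P]_x f^\+ (V x))%E.
  by apply: eq_integral => x _; rewrite (congr1 (@^~ x) (funepos_comp f V)).
have negE (V : T -> X * Y) :
    (\int[P]_x (fun y => f (V y))^\- x = \int[P]_x f^\- (V x))%E.
  by apply: eq_integral => x _; rewrite (congr1 (@^~ x) (funeneg_comp f V)).
rewrite integralE [RHS]integralE !posE !negE !E//.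
  exact: measurable_funeneg.
exact: measurable_funepos.
Qed.

End identical_pairs.

Section stationary_pairs.
Context {d : measure_display} {T : measurableType d} {R : realType}.
Variables (P : probability T R) (r : int -> T -> R).
Hypothesis mr : forall t, measurable_fun setT (r t).
Hypothesis statr : strictly_stationary P r.

(** Stationarity attaches a single set to each time, so prescribing [A] at s and [B] at t requires
    distinct times. *)
Lemma stationary_integral2 (f : R * R -> \bar R) s t tau :
  measurable_fun setT f -> s != t ->
  (\int[P]_x f (r (s + tau) x, r (t + tau) x) = \int[P]_x f (r s x, r t x))%E.
Proof.
move=> mf st; apply: integral_eq_distribution => // A B mA mB.
have mC i : measurable (if i == s then A else B) by case: ifP.
have := statr [:: s; t] (fun i => if i == s then A else B) tau mC.
by rewrite !big_cons !big_nil eqxx eq_sym (negbTE st) !setIT.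
Qed.

Lemma stationary_integral1 (f : R -> \bar R) t : measurable_fun setT f ->
  (\int[P]_x f (r t x) = \int[P]_x f (r 0 x))%E.
Proof.
move=> mf; have m1 : @measurable_fun _ _ _ (\bar R) [set: R * R] (f \o fst).
  by apply: measurableT_comp.
by have := stationary_integral2 _ 0 1 t m1 isT; rewrite /= add0r.
Qed.

End stationary_pairs.

Section ae_past.
Context {d : measure_display} {T : measurableType d} {R : realType}.
Variables (P : probability T R) (zeta : int -> T -> R).
Hypothesis mzeta : forall t, measurable_fun setT (zeta t).

(** [P] need not be complete, so being almost surely equal to a past-measurable [g] does not make
    [f] measurable; this is recorded separately. *)
Definition ae_past (t : int) (f : T -> R) :=
  measurable_fun setT f /\ exists2 g : T -> R,
    measurable_fun [set: g_sigma_algebraType (past_gen zeta t)] g &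
    {ae P, forall x, f x = g x}.

Lemma measurable_past t (g : T -> R) :
  measurable_fun [set: g_sigma_algebraType (past_gen zeta t)] g ->
  measurable_fun [set: T] g.
Proof.
by move=> mg _ B mB; have := mg measurableT B mB; exact: past_measurable.
Qed.

Lemma ae_past_le s t f : s <= t -> ae_past s f -> ae_past t f.
Proof.
move=> st [mf [g mg fg]]; split=> //; exists g => // _ B mB.
apply: (sub_sigma_algebra2 (sub_past_gen zeta _ _ st)).
exact: (mg measurableT B mB).
Qed.

Lemma ae_past_cst t (a : R) : ae_past t (fun=> a).
Proof. by split=> //; exists (fun=> a) => //; exact: aeW. Qed.

Lemma ae_past_comp t (h : R -> R) f : measurable_fun setT h ->
  ae_past t f -> ae_past t (fun x => h (f x)).
Proof.
move=> mh [mf [g mg fg]]; split; first exact: measurableT_comp.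
exists (fun x => h (g x)); first exact: measurableT_comp mh mg.
by apply: filterS fg => x ->.
Qed.

Lemma ae_pastD t f1 f2 : ae_past t f1 -> ae_past t f2 ->
  ae_past t (fun x => f1 x + f2 x).
Proof.
move=> [m1 [g1 mg1 fg1]] [m2 [g2 mg2 fg2]]; split; first exact: measurable_funD.
exists (fun x => g1 x + g2 x); first exact: measurable_funD.
by apply: filterS2 fg1 fg2 => x -> ->.
Qed.

Lemma ae_pastM t f1 f2 : ae_past t f1 -> ae_past t f2 ->
  ae_past t (fun x => f1 x * f2 x).
Proof.
move=> [m1 [g1 mg1 fg1]] [m2 [g2 mg2 fg2]]; split; first exact: measurable_funM.
exists (fun x => g1 x * g2 x); first exact: measurable_funM.
by apply: filterS2 fg1 fg2 => x -> ->.
Qed.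

Lemma adapted_ae_past (r : int -> T -> R) t : measurable_fun setT (r t) ->
  adapted zeta r -> ae_past t (r t).
Proof.
move=> mr ad; split=> //; exists (r t); last exact: aeW.
by move=> _ B mB; rewrite setTI; exact: ad.
Qed.

Lemma ae_cvg_past t (f_ : nat -> T -> R) (f : T -> R) : measurable_fun setT f ->
  (forall n, ae_past t (f_ n)) ->
  {ae P, forall x, f_ ^~ x @ \oo --> f x} -> ae_past t f.
Proof.
move=> mf pf cf; split=> //.
pose g_ n := sval (cid2 (pf n).2).
have mg n : measurable_fun [set: g_sigma_algebraType (past_gen zeta t)] (g_ n).
  by rewrite /g_; case: cid2.
have fg : {ae P, forall x n, f_ n x = g_ n x}.
  by apply/ae_foralln => n; rewrite /g_; case: cid2.
(* The versions may diverge on a null set. Their upper limit exists everywhere, is measurable for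
   the past, and equals the limit wherever there is one. *)
exists (fun x => fine (limn_esup (fun n => (g_ n x)%:E))).
  have mes : measurable_fun [set: g_sigma_algebraType (past_gen zeta t)]
      (fun x => limn_esup (fun n => (g_ n x)%:E)).
    by apply: measurable_fun_limn_esup => n; exact/measurable_EFinP.
  apply: measurableT_comp mes.
  by [].
apply: filterS2 cf fg => x cx ex.
rewrite (_ : (fun n => (g_ n x)%:E) = (fun n => (f_ n x)%:E)); last first.
  by apply/funext => n; rewrite ex.
have cE : (f_ n x)%:E @[n --> \oo] --> (f x)%:E.
  by apply: cvg_EFin; [exact: nearW|exact: cx].
by rewrite is_cvg_limn_esupE ?(cvg_lim _ cE)//; apply/cvg_ex; exists (f x)%:E.
Qed.

(** Along a subsequence whose squared L^2 distances are at most 2^-(k+1), the series of squared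
    differences has finite integral. It is thus finite almost everywhere, and its terms tend to 0
    there. *)
Lemma L2_cvg_past t (f_ : nat -> T -> R) (f : T -> R) :
  measurable_fun setT f -> (forall n, ae_past t (f_ n)) ->
  (\int[P]_x ((f_ n x - f x) ^+ 2)%:E @[n --> \oo] --> (0 : \bar R))%E ->
  ae_past t f.
Proof.
move=> mf pf cf.
have sub k : exists n,
    (\int[P]_x ((f_ n x - f x) ^+ 2)%:E <= ((1 / (2 ^ k.+1)%:R) : R)%:E)%E.
  have : \forall n \near \oo, (\int[P]_x ((f_ n x - f x) ^+ 2)%:E <
      ((1 / (2 ^ k.+1)%:R) : R)%:E)%E.
    have /fine_cvgP[fincf cf0] := cf.
    have e0 : 0 < (1 / (2 ^ k.+1)%:R :> R).
      by rewrite divr_gt0// ltr0n expn_gt0.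
    move/cvgrPdist_lt : cf0 => /(_ _ e0) cf0.
    apply: filterS2 fincf cf0 => n fn; rewrite sub0r normrN => cfn.
    rewrite -(fineK fn) lte_fin (le_lt_trans _ cfn)//; exact: ler_norm.
  by case=> N _ /(_ N (leqnn N)) /ltW; exists N.
pose u k := sval (cid (sub k)).
have uP k : (\int[P]_x ((f_ (u k) x - f x) ^+ 2)%:E <=
    ((1 / (2 ^ k.+1)%:R) : R)%:E)%E by rewrite /u; case: cid.
have md k : measurable_fun setT (fun x => ((f_ (u k) x - f x) ^+ 2)%:E).
  apply/measurable_EFinP; apply: (@measurable_funX _ _ _ _ (fun x => f_ (u k) x - f x)).
  by apply: measurable_funB => //; have [] := pf (u k).
have int_fin : P.-integrable setT
    (fun x => \sum_(0 <= k <oo) ((f_ (u k) x - f x) ^+ 2)%:E)%E.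
  apply/integrableP; split.
    by apply: ge0_emeasurable_sum => // k x _ _; rewrite lee_fin sqr_ge0.
  under eq_integral => x _.
    rewrite gee0_abs; last first.
      by apply: nneseries_ge0 => k _ _; rewrite lee_fin sqr_ge0.
    over.
  rewrite integral_nneseries//; last by move=> k x _; rewrite lee_fin sqr_ge0.
  apply: (@le_lt_trans _ _ (\sum_(0 <= k <oo) ((1 / (2 ^ k.+1)%:R) : R)%:E)%E).
    by apply: lee_nneseries => // k _ _; apply: integral_ge0 => x _; rewrite lee_fin sqr_ge0.
  apply: le_lt_trans (epsilon_trick0 xpredT (@ler01 R)) _ => //.
  by rewrite ltry.
apply: (ae_cvg_past _ (fun k => f_ (u k))) => //.
apply: filterS (integrable_ae measurableT int_fin) => x /(_ I) finx.
have nn k : (0 <= ((f_ (u k) x - f x) ^+ 2)%:E :> \bar R)%E by rewrite lee_fin sqr_ge0.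
have lty : (\sum_(0 <= k <oo) ((f_ (u k) x - f x) ^+ 2)%:E < +oo)%E.
  by rewrite -ge0_fin_numE// nneseries_ge0.
have tail := nneseries_tail_cvg lty (fun k _ => nn k).
apply/cvgrPdist_lt => e e0.
have e20 : 0 < e ^+ 2 by rewrite exprn_gt0.
have /fine_cvgP[fint t0] := tail.
move/cvgrPdist_lt : t0 => /(_ _ e20) t0.
apply: filterS2 fint t0 => n fn; rewrite sub0r normrN => tn.
rewrite distrC -(ltr_pXn2r (n := 2))// ?nnegrE ?ltW//.
rewrite real_normK ?num_real// -lte_fin.
(* A term of the convergent series is at most the tail that starts with it. *)
apply: (le_lt_trans (y := (\sum_(n <= k <oo) ((f_ (u k) x - f x) ^+ 2)%:E)%E)).
  have := nneseries_lim_ge n.+1 (P := xpredT) (fun k (_ : (n <= k)%N) _ => nn k).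
  by rewrite big_nat1.
by rewrite -(fineK fn) lte_fin (le_lt_trans _ tn)//; exact: ler_norm.
Qed.

End ae_past.

(** * Third-order moments *)

Section L3.
Context {d : measure_display} {T : measurableType d} {R : realType}.
Variable P : probability T R.

Definition L3 (X : T -> R) :=
  measurable_fun setT X /\ P.-integrable setT (fun x => (`|X x| ^+ 3)%:E).

(** A symmetric trilinear form on [L3]. A slot filled with [fun=> 1] lowers the order, so means and
    second moments obey the same rules. *)
Definition E3 (X Y Z : T -> R) := \int[P]_x (X x * Y x * Z x).

Lemma le_integrable_EFin (X Y : T -> R) : measurable_fun setT X ->
  (forall x, `|X x| <= Y x) -> P.-integrable setT (fun x => (Y x)%:E) ->
  P.-integrable setT (fun x => (X x)%:E).
Proof.
move=> mX XY; apply: le_integrable => //; first exact/measurable_EFinP.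
by move=> x _; rewrite lee_fin (le_trans (XY x))// ler_norm.
Qed.

Lemma integrable_EFinD (X Y : T -> R) :
  P.-integrable setT (fun x => (X x)%:E) ->
  P.-integrable setT (fun x => (Y x)%:E) ->
  P.-integrable setT (fun x => (X x + Y x)%:E).
Proof. by move=> iX iY; under eq_fun do rewrite EFinD; exact: integrableD. Qed.

Lemma integrable_EFinZ (a : R) (X : T -> R) :
  P.-integrable setT (fun x => (X x)%:E) ->
  P.-integrable setT (fun x => (a * X x)%:E).
Proof. by move=> iX; under eq_fun do rewrite EFinM; exact: integrableZl. Qed.

Lemma ae_eq_integrable_EFin (X Y : T -> R) : measurable_fun setT X ->
  measurable_fun setT Y -> {ae P, forall x, X x = Y x} ->
  P.-integrable setT (fun x => (X x)%:E) ->
  P.-integrable setT (fun x => (Y x)%:E).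
Proof.
move=> mX mY XY /integrableP[_ iX]; apply/integrableP; split.
  exact/measurable_EFinP.
rewrite (ae_eq_integral (fun x => `|(X x)%:E|)%E)//.
- exact/measurableT_comp/measurable_EFinP.
- exact/measurableT_comp/measurable_EFinP.
- by apply: filterS XY => x -> _.
Qed.

Lemma ae_eq_Rintegral (X Y : T -> R) : measurable_fun setT X ->
  measurable_fun setT Y -> {ae P, forall x, X x = Y x} ->
  \int[P]_x X x = \int[P]_x Y x.
Proof.
move=> mX mY XY; congr fine; apply: ae_eq_integral => //.
- exact/measurable_EFinP.
- exact/measurable_EFinP.
- by apply: filterS XY => x -> _.
Qed.

Lemma Rintegral_cst_probability (a : R) : \int[P]_x a = a.
Proof. by rewrite /Rintegral integral_cst//= probability_setT mule1. Qed.

Lemma le_L3 (X Y : T -> R) : measurable_fun setT X ->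
  (forall x, `|X x| <= `|Y x|) -> L3 Y -> L3 X.
Proof.
move=> mX XY [_ iY]; split=> //; apply: le_integrable_EFin iY.
  by apply/measurable_funX/measurableT_comp.
by move=> x; rewrite normrX normr_id lerXn2r ?nnegrE.
Qed.

Lemma L3_cst (a : R) : L3 (fun=> a).
Proof. by split=> //; exact: finite_measure_integrable_cst. Qed.

Lemma L3D X Y : L3 X -> L3 Y -> L3 (fun x => X x + Y x).
Proof.
move=> [mX iX] [mY iY]; split; first exact: measurable_funD.
apply: (@le_integrable_EFin _ (fun x => 4 * (`|X x| ^+ 3 + `|Y x| ^+ 3))).
- exact/measurable_funX/measurableT_comp/measurable_funD.
- move=> x; rewrite normrX normr_id.
  apply: (@le_trans _ _ ((`|X x| + `|Y x|) ^+ 3)).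
    by rewrite lerXn2r ?nnegrE ?addr_ge0// ler_normD.
  have := normr_ge0 (X x); have := normr_ge0 (Y x).
  move: `|X x| `|Y x| => u v v0 u0.
  (* 4 (u^3 + v^3) - (u + v)^3 is three times this product. *)
  have : 0 <= (u + v) * (u - v) ^+ 2 by rewrite mulr_ge0 ?sqr_ge0 ?addr_ge0.
  by lra.
- under eq_fun do rewrite EFinM.
  by apply: integrableZl => //; exact: integrable_EFinD.
Qed.

Lemma L3Z a X : L3 X -> L3 (fun x => a * X x).
Proof.
move=> [mX iX]; split; first exact: measurable_funM.
under eq_fun do rewrite normrM exprMn EFinM.
exact: integrableZl.
Qed.

Lemma L3_integrableM X Y Z : L3 X -> L3 Y -> L3 Z ->
  P.-integrable setT (fun x => (X x * Y x * Z x)%:E).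
Proof.
move=> [mX iX] [mY iY] [mZ iZ].
apply: (@le_integrable_EFin _ (fun x => `|X x| ^+ 3 + `|Y x| ^+ 3 + `|Z x| ^+ 3)).
- by apply: measurable_funM => //; exact: measurable_funM.
- move=> x; rewrite !normrM.
  have := normr_ge0 (X x); have := normr_ge0 (Y x); have := normr_ge0 (Z x).
  move: `|X x| `|Y x| `|Z x| => u v w w0 v0 u0.
  (* This product is 2 (u^3 + v^3 + w^3 - 3 u v w), which gives the inequality between arithmetic
     and geometric means. *)
  have h1 : 0 <= (u + v + w) * ((u - v) ^+ 2 + (v - w) ^+ 2 + (w - u) ^+ 2).
    by rewrite mulr_ge0 ?addr_ge0 ?sqr_ge0.
  have h2 : 0 <= u * v * w by rewrite !mulr_ge0.
  by lra.
- by apply: integrable_EFinD => //; exact: integrable_EFinD.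
Qed.

Lemma L3_integrable X : L3 X -> P.-integrable setT (fun x => (X x)%:E).
Proof.
move=> L3X; have := L3_integrableM X (fun=> 1) (fun=> 1) L3X (L3_cst 1) (L3_cst 1).
by under eq_fun do rewrite !mulr1.
Qed.

Lemma E3C12 X Y Z : E3 X Y Z = E3 Y X Z.
Proof. by apply: eq_Rintegral => x _; rewrite (mulrC (X x)). Qed.

Lemma E3C23 X Y Z : E3 X Y Z = E3 X Z Y.
Proof. by apply: eq_Rintegral => x _; rewrite -!mulrA (mulrC (Y x)). Qed.

Lemma E3D X X' Y Z : L3 X -> L3 X' -> L3 Y -> L3 Z ->
  E3 (fun x => X x + X' x) Y Z = E3 X Y Z + E3 X' Y Z.
Proof.
move=> LX LX' LY LZ; rewrite /E3 -RintegralD//; [|exact: L3_integrableM..].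
by apply: eq_Rintegral => x _; rewrite -mulrDl -mulrDl.
Qed.

Lemma E3Z a X Y Z : L3 X -> L3 Y -> L3 Z ->
  E3 (fun x => a * X x) Y Z = a * E3 X Y Z.
Proof.
move=> LX LY LZ; rewrite /E3 -RintegralZl//; last exact: L3_integrableM.
by apply: eq_Rintegral => x _; rewrite !mulrA.
Qed.

Lemma E3DZr a X Y Z Z' : L3 X -> L3 Y -> L3 Z -> L3 Z' ->
  E3 X Y (fun x => Z x + a * Z' x) = E3 X Y Z + a * E3 X Y Z'.
Proof.
move=> LX LY LZ LZ'.
have i1 := L3_integrableM X Y Z LX LY LZ.
have i2 := L3_integrableM X Y Z' LX LY LZ'.
rewrite /E3 -RintegralZl// -RintegralD//; last exact: integrable_EFinZ.
by apply: eq_Rintegral => x _; ring.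
Qed.

Lemma E3_sqrD X Y Z : L3 X -> L3 Y -> L3 Z ->
  E3 (fun x => X x + Y x) (fun x => X x + Y x) Z =
  E3 X X Z + 2 * E3 X Y Z + E3 Y Y Z.
Proof.
move=> LX LY LZ; have LXY := L3D _ _ LX LY.
rewrite E3D// (E3C12 X (fun x => _ + _)) (E3C12 Y (fun x => _ + _)) !E3D// (E3C12 Y X).
by ring.
Qed.

(** A crude substitute for Hölder's inequality, enough to bound the D_j uniformly in j. *)
Lemma normr_E3 X Y Z : L3 X -> L3 Y -> L3 Z ->
  `|E3 X Y Z| <= \int[P]_x `|X x| ^+ 3 + \int[P]_x `|Y x| ^+ 3
    + \int[P]_x `|Z x| ^+ 3.
Proof.
move=> LX LY LZ; have iXYZ := L3_integrableM _ _ _ LX LY LZ.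
apply: le_trans (le_normr_Rintegral _ iXYZ) _ => //.
have [_ iX] := LX; have [_ iY] := LY; have [_ iZ] := LZ.
have iXY : P.-integrable setT (EFin \o (fun x => `|X x| ^+ 3 + `|Y x| ^+ 3)).
  exact: integrable_EFinD.
rewrite -!RintegralD//; apply: le_Rintegral => //.
- exact: integrable_norm iXYZ.
- exact: integrable_EFinD.
- move=> x _; rewrite !normrM.
  have := normr_ge0 (X x); have := normr_ge0 (Y x); have := normr_ge0 (Z x).
  move: `|X x| `|Y x| `|Z x| => u v w w0 v0 u0.
  have h1 : 0 <= (u + v + w) * ((u - v) ^+ 2 + (v - w) ^+ 2 + (w - u) ^+ 2).
    by rewrite mulr_ge0 ?addr_ge0 ?sqr_ge0.
  have h2 : 0 <= u * v * w by rewrite !mulr_ge0.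
  by lra.
Qed.

End L3.

(** * Factoring the innovation out of expectations *)

Section innovations.
Context {d : measure_display} {T : measurableType d} {R : realType}.
Variables (P : probability T R) (zeta : int -> T -> R).
Hypothesis mzeta : forall t, measurable_fun setT (zeta t).
Hypothesis ind : mutually_independent P zeta.

Lemma ge0_integral_zeta_past t (f : R -> R) (W : T -> R) :
  measurable_fun setT f -> (forall y, 0 <= f y) ->
  (forall x, 0 <= W x) -> ae_past P zeta (t - 1) W ->
  (\int[P]_x (f (zeta t x) * W x)%:E =
   \int[P]_x (f (zeta t x))%:E * \int[P]_x (W x)%:E)%E.
Proof.
move=> mf f0 W0 [mW [g mg Wg]].
have mg' := measurable_past zeta mzeta _ _ mg.
pose F := g_sigma_algebraType (past_gen zeta (t - 1)).
have mid : @measurable_fun _ _ T F setT idfun.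
  by move=> _ B mB; rewrite setTI; exact: past_measurable mB.
have mng : @measurable_fun _ _ F R setT (fun x => `|g x|) by exact: measurableT_comp.
have fz : measurable_fun setT (fun x => f (zeta t x)) by exact: measurableT_comp.
(* The version [g] of [W] is nonnegative only almost everywhere; its absolute value is a version
   that is nonnegative everywhere. *)
have := @ge0_integral_indepM _ _ _ T R F R P (zeta t) idfun (mzeta t) mid _
  f (fun x => `|g x|) mf mng f0 (fun x => normr_ge0 _).
rewrite (ae_eq_integral (fun x => (f (zeta t x) * W x)%:E)%E)//; last 1 first.
- by apply: filterS Wg => x <- _; rewrite /= ger0_norm.
- rewrite (ae_eq_integral (fun x => (W x)%:E)%E (fun x => `|g x|%:E))//.
  + by apply; move=> A B mA mB; exact: (indep_past P zeta mzeta t ind).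
  + exact/measurable_EFinP/measurableT_comp.
  + exact/measurable_EFinP.
  + by apply: filterS Wg => x <- _; rewrite /= ger0_norm.
- by apply/measurable_EFinP/measurable_funM => //; exact: measurableT_comp.
- exact/measurable_EFinP/measurable_funM.
Qed.

Lemma Rintegral_zeta_past t (f : R -> R) (W : T -> R) :
  measurable_fun setT f -> P.-integrable setT (fun x => (f (zeta t x))%:E) ->
  P.-integrable setT (fun x => (W x)%:E) -> ae_past P zeta (t - 1) W ->
  \int[P]_x (f (zeta t x) * W x) = \int[P]_x f (zeta t x) * \int[P]_x W x.
Proof.
move=> mf iz iW [mW [g mg Wg]].
have mg' := measurable_past zeta mzeta _ _ mg.
pose F := g_sigma_algebraType (past_gen zeta (t - 1)).
have mid : @measurable_fun _ _ T F setT idfun.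
  by move=> _ B mB; rewrite setTI; exact: past_measurable mB.
have fz : measurable_fun setT (fun x => f (zeta t x)) by exact: measurableT_comp.
have ig := ae_eq_integrable_EFin P _ _ mW mg' Wg iW.
have idp A B : measurable A -> measurable (B : set F) ->
    P (zeta t @^-1` A `&` idfun @^-1` B) =
    (P (zeta t @^-1` A) * P (idfun @^-1` B))%E.
  by move=> mA mB; exact: (indep_past P zeta mzeta t ind).
have := @Rintegral_indepM _ _ _ T R F R P (zeta t) idfun (mzeta t) mid idp
  f g mf mg iz ig.
rewrite (ae_eq_Rintegral P W g)// => <-; apply: ae_eq_Rintegral.
- exact: measurable_funM.
- exact: measurable_funM.
- by apply: filterS Wg => x ->.
Qed.

Lemma integral_zeta_stationary t (f : R -> \bar R) :
  identically_distributed P zeta -> measurable_fun setT f ->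
  (\int[P]_x f (zeta t x) = \int[P]_x f (zeta 0 x))%E.
Proof.
move=> idz mf.
have m1 : @measurable_fun _ _ _ (\bar R) [set: R * R] (f \o fst).
  by apply: measurableT_comp.
(* The statement on pairs is applied to the diagonal pair, where the rectangle of A and B becomes
   the single event that [zeta t] lies in both. *)
apply: (integral_eq_distribution P (zeta t) (zeta 0) (zeta t) (zeta 0)
  _ _ _ _ _ (f \o fst)) => // A B mA mB.
have := idz t _ (measurableI _ _ mA mB).
by rewrite !preimage_setI.
Qed.

End innovations.

(* Where |X| <= m, X^2 |Y| is controlled by the L^2 norm of Y; where |X| > m,
   u^2 v <= L u^3 + v^3 / L and the cube of X has a small integral. *)
Lemma weak_cvg_E3 {d : measure_display} {T : measurableType d} {R : realType}
  (P : probability T R) (X : T -> R) (Y : nat -> T -> R) (K : R) :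
  L3 P X -> (forall n, L3 P (Y n)) ->
  (forall n, \int[P]_x `|Y n x| ^+ 3 <= K) ->
  (\int[P]_x ((Y n x) ^+ 2)%:E @[n --> \oo] --> (0 : \bar R))%E ->
  E3 P X X (Y n) @[n --> \oo] --> (0 : R).
Proof.
move=> LX LY YK Y20; have [mX iX] := LX.
pose q (m : nat) x := if `|X x| <= m%:R then 0 else `|X x| ^+ 3.
have mq m : measurable_fun setT (q m).
  apply: measurable_fun_ifT => //.
    by apply: measurable_fun_ler => //; exact: measurableT_comp.
  exact/measurable_funX/measurableT_comp.
have q0 m x : 0 <= q m x by rewrite /q; case: ifP => // _; rewrite exprn_ge0.
have qX m x : q m x <= `|X x| ^+ 3.
  by rewrite /q; case: ifP => // _; rewrite exprn_ge0.
have iq m : P.-integrable setT (fun x => (q m x)%:E).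
  apply: (le_integrable_EFin P) iX => // x; rewrite ger0_norm//; exact: qX.
have q_cvg : \int[P]_x q m x @[m --> \oo] --> 0.
  have [] := @dominated_convergence _ T R P setT measurableT
    (fun m x => (q m x)%:E) (fun=> 0%E) (fun x => (`|X x| ^+ 3)%:E).
  - by move=> m; exact/measurable_EFinP.
  - by [].
  - apply: aeW => x _; apply: cvg_near_cst; near=> m.
    rewrite /q ifT//; near: m.
    exists (Num.truncn `|X x|).+1 => // n /= Xn.
    apply: ltW; apply: (lt_le_trans (truncnS_gt _)); by rewrite ler_nat.
  - exact: iX.
  - by apply: aeW => x m _ /=; rewrite lee_fin ger0_norm ?q0 ?qX.
  by rewrite integral0 => _ _ /fine_cvgP[_].
have iY2 n : P.-integrable setT (fun x => (Y n x ^+ 2)%:E).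
  have := L3_integrableM P _ _ _ (LY n) (LY n) (L3_cst P 1).
  by under eq_fun do rewrite mulr1 -expr2.
have Y2_cvg : \int[P]_x (Y n x ^+ 2) @[n --> \oo] --> 0.
  by move/fine_cvgP : Y20 => [].
have K0 : 0 <= K.
  by apply: le_trans (YK 0); apply: Rintegral_ge0 => x _; rewrite exprn_ge0.
have bound (m n : nat) (L eta : R) : 1 <= L -> 0 < eta ->
    `|E3 P X X (Y n)| <= m%:R ^+ 2 * eta + m%:R ^+ 2 / eta * \int[P]_x (Y n x ^+ 2)
       + L * \int[P]_x q m x + L^-1 * K.
  move=> L1 eta0; have L0 : 0 < L by exact: lt_le_trans L1.
  have iXY := L3_integrableM P _ _ _ LX LX (LY n).
  have [mY iY] := LY n.
  apply: le_trans (le_normr_Rintegral _ iXY) _ => //.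
  have i1 : P.-integrable setT (fun x => (m%:R ^+ 2 * eta)%:E).
    exact: finite_measure_integrable_cst.
  have i2 : P.-integrable setT (fun x => (m%:R ^+ 2 / eta * Y n x ^+ 2)%:E).
    exact: integrable_EFinZ.
  have i3 : P.-integrable setT (fun x => (L * q m x)%:E).
    exact: integrable_EFinZ.
  have i4 : P.-integrable setT (fun x => (L^-1 * `|Y n x| ^+ 3)%:E).
    exact: integrable_EFinZ.
  have i12 := integrable_EFinD P _ _ i1 i2.
  have i123 := integrable_EFinD P _ _ i12 i3.
  have i1234 := integrable_EFinD P _ _ i123 i4.
  apply: (@le_trans _ _ (\int[P]_x (m%:R ^+ 2 * eta + m%:R ^+ 2 / eta * Y n x ^+ 2
       + L * q m x + L^-1 * `|Y n x| ^+ 3))).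
    apply: le_Rintegral => //; first exact: integrable_norm iXY.
    move=> x _; rewrite !normrM -(real_normK (num_real (Y n x))).
    rewrite /q; have := normr_ge0 (X x); have := normr_ge0 (Y n x).
    move: `|X x| `|Y n x| => u v v0 u0.
    (* The first term covers v <= eta and the second v >= eta. This trades the first power of [Y]
       for its square, the quantity known to vanish. *)
    have t1 : v <= eta + v ^+ 2 / eta.
      rewrite -(ler_pM2r eta0) mulrDl divfK ?gt_eqF//.
      have := sqr_ge0 (v - eta); have := mulr_ge0 v0 (ltW eta0).
      have := sqr_ge0 eta; have := sqr_ge0 v. nra.
    have t2 : 0 <= m%:R ^+ 2 * eta + m%:R ^+ 2 / eta * v ^+ 2.
      by rewrite addr_ge0// !mulr_ge0 ?sqr_ge0// ?invr_ge0 ltW.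
    have t3 : 0 <= L^-1 * v ^+ 3.
      by rewrite mulr_ge0 ?exprn_ge0 ?invr_ge0 ?(ltW L0).
    case: ifPn => [um|_].
      rewrite mulr0 addr0; apply: (@le_trans _ _ (m%:R ^+ 2 * v)).
        by rewrite ler_wpM2r// -expr2 lerXn2r ?nnegrE.
      have -> : m%:R ^+ 2 * eta + m%:R ^+ 2 / eta * v ^+ 2 =
        m%:R ^+ 2 * (eta + v ^+ 2 / eta) by ring.
      by apply: ler_wpDr => //; rewrite ler_wpM2l ?sqr_ge0.
    have [vLu|Luv] := leP v (L * u).
      rewrite -addrA; apply: ler_wpDl => //; apply: ler_wpDr => //.
      by rewrite [leRHS](_ : _ = u * u * (L * u)) ?ler_wpM2l ?mulr_ge0//; ring.
    apply: ler_wpDl; first by rewrite addr_ge0// mulr_ge0 ?exprn_ge0 ?(ltW L0).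
    have uv : u * u <= L^-1 * v ^+ 2.
      rewrite -(ler_pM2l L0) mulVKf ?gt_eqF// mulrA expr2.
      apply: ler_pM => //; [by rewrite mulr_ge0 ?(ltW L0)|exact: ltW|].
      by apply: ltW; apply: le_lt_trans Luv; rewrite ler_peMl.
    by rewrite exprSr mulrA ler_wpM2r.
  rewrite !RintegralD// Rintegral_cst_probability !RintegralZl//; last 2 first.
  - exact: iY2.
  - exact: iq.
  by rewrite lerD2l ler_wpM2l ?invr_ge0 ?(ltW L0).
apply/cvgrPdist_le => e e0.
have e40 : 0 < e / 4 by rewrite divr_gt0.
(* The order of choice matters: [L] absorbs [K], then m depends on [L], then [eta] on m, and n comes
   last. Each of the four terms of [bound] gets e / 4. *)
pose L := K / (e / 4) + 1.
have L1 : 1 <= L by rewrite lerDr divr_ge0// ltW.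
have L0 : 0 < L by exact: lt_le_trans L1.
have LK : L^-1 * K <= e / 4.
  rewrite ler_pdivrMl// /L mulrDl divfK ?gt_eqF// mul1r lerDl; exact: ltW.
have [m qm] : exists m, L * \int[P]_x q m x <= e / 4.
  move/cvgrPdist_le : q_cvg => /(_ (e / 4 / L)) [|N _ /(_ N (leqnn N)) /=].
    by rewrite divr_gt0.
  rewrite sub0r normrN ger0_norm; last by apply: Rintegral_ge0 => x _; exact: q0.
  by rewrite ler_pdivlMr// mulrC; exists N.
pose eta := (e / 4) / (m%:R ^+ 2 + 1).
have M0 : 0 < m%:R ^+ 2 + 1 :> R by rewrite ltr_wpDl// sqr_ge0.
have eta0 : 0 < eta by rewrite divr_gt0.
have h1 : m%:R ^+ 2 * eta <= e / 4.
  rewrite /eta mulrA ler_pdivrMr// mulrC ler_pM2l//; lra.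
pose D := m%:R ^+ 2 / eta + 1.
have D0 : 0 < D by rewrite ltr_wpDl// mulr_ge0 ?sqr_ge0// invr_ge0 ltW.
move/cvgrPdist_le : Y2_cvg => /(_ (e / 4 / D)) [|N _ NP]; first by rewrite divr_gt0.
exists N => // n Nn /=; rewrite sub0r normrN.
have Y2n0 : 0 <= \int[P]_x (Y n x ^+ 2).
  by apply: Rintegral_ge0 => x _; rewrite sqr_ge0.
have := NP n Nn; rewrite /= sub0r normrN ger0_norm// ler_pdivlMr// => NPn.
have h2 : m%:R ^+ 2 / eta * \int[P]_x (Y n x ^+ 2) <= e / 4.
  apply: le_trans NPn; rewrite mulrC ler_wpM2l// /D; lra.
apply: le_trans (bound m n L eta L1 eta0) _; lra.
Unshelve. all: by end_near. Qed.

(** * The real recursion *)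

Section recursion.
Context {R : realType}.

Lemma Cauchy_Schwarz_sum (I : Type) (s : seq I) (f g : I -> R) :
  (\sum_(i <- s) f i * g i) ^+ 2 <=
  (\sum_(i <- s) f i ^+ 2) * (\sum_(i <- s) g i ^+ 2).
Proof.
elim: s => [|i s IH]; first by rewrite !big_nil expr0n mul0r.
rewrite !big_cons.
have F0 : 0 <= \sum_(j <- s) f j ^+ 2 by apply: sumr_ge0 => j _; exact: sqr_ge0.
have G0 : 0 <= \sum_(j <- s) g j ^+ 2 by apply: sumr_ge0 => j _; exact: sqr_ge0.
move: IH F0 G0; move: (\sum_(j <- s) f j * g j) => S.
move: (\sum_(j <- s) f j ^+ 2) (\sum_(j <- s) g j ^+ 2) => F G.
move: (f i) (g i) => u v SFG F0 G0.
(* The cross term of the induction: with S^2 <= F G, its square is at most 4 (F v^2) (G u^2), hence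
   at most the square of the right-hand side. *)
have h : 2 * S * (u * v) <= F * v ^+ 2 + G * u ^+ 2.
  have RHS0 : 0 <= F * v ^+ 2 + G * u ^+ 2.
    by apply: addr_ge0; apply: mulr_ge0 => //; exact: sqr_ge0.
  apply: (le_trans (ler_norm _)).
  rewrite -(ler_pXn2r (n := 2))// ?nnegrE//.
  rewrite real_normK ?num_real//.
  have -> : (2 * S * (u * v)) ^+ 2 = 4 * (u * v) ^+ 2 * S ^+ 2 by ring.
  apply: (@le_trans _ _ (4 * (u * v) ^+ 2 * (F * G))).
    by rewrite ler_wpM2l// mulr_ge0 ?sqr_ge0.
  rewrite -subr_ge0.
  have -> : (F * v ^+ 2 + G * u ^+ 2) ^+ 2 - 4 * (u * v) ^+ 2 * (F * G) =
    (F * v ^+ 2 - G * u ^+ 2) ^+ 2 by ring.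
  exact: sqr_ge0.
have -> : (u * v + S) ^+ 2 = S ^+ 2 + 2 * S * (u * v) + u ^+ 2 * v ^+ 2 by ring.
have -> : (u ^+ 2 + F) * (v ^+ 2 + G) =
  F * G + (F * v ^+ 2 + G * u ^+ 2) + u ^+ 2 * v ^+ 2 by ring.
by rewrite lerD2r lerD.
Qed.

Lemma sum_convolution (u g : nat -> R) N :
  \sum_(1 <= j < N.+1) \sum_(1 <= i < j) u i * g (j - i)%N =
  \sum_(1 <= i < N.+1) u i * \sum_(1 <= j < (N - i).+1) g j.
Proof.
elim: N => [|N IH]; first by rewrite !big_geq.
rewrite big_nat_recr//= IH [RHS]big_nat_recr//= subnn.
rewrite [X in _ = _ + _ * X]big_geq// mulr0 addr0.
rewrite -big_split/=; apply: eq_big_nat => i /andP[i1 iN].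
by rewrite -mulrDr subSn// [in RHS]big_nat_recr.
Qed.

(** Truncated Young inequality for the convolution of two l^1 sequences, to be used with the squares
    of b and h. *)
Lemma le_sum_convolution (u g : nat -> R) N :
  (forall i, 0 <= u i) -> (forall i, 0 <= g i) ->
  \sum_(1 <= j < N.+1) \sum_(1 <= i < j) u i * g (j - i)%N <=
  (\sum_(1 <= i < N.+1) u i) * \sum_(1 <= j < N.+1) g j.
Proof.
move=> u0 g0; rewrite sum_convolution mulr_suml; apply: ler_sum_nat => i /andP[i1 iN].
apply: ler_wpM2l => //.
rewrite [leRHS](big_cat_nat (n := (N - i).+1))//= ?ltnS ?leq_subr//.
by rewrite lerDl sumr_ge0.
Qed.

(** With A = |a| m + delta this is the square of ||h|| <= 2 A sqrt(beta) / (1 - beta), the outcome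
    of Minkowski's inequality ||h|| <= 2 A sqrt(beta) + beta ||h||. Working with squares term by
    term avoids square roots. *)
Lemma sum_h_sqr_le (b h D : nat -> R) (a m beta : R) delta N :
  0 < m -> 0 < beta -> 5 * beta < 1 ->
  (forall N, \sum_(1 <= i < N.+1) b i ^+ 2 <= beta) ->
  (forall j, (0 < j)%N ->
    h j = 2 * b j * (a * m + D j) +
          \sum_(1 <= i < j) b i ^+ 2 * h (j - i)%N) ->
  0 <= delta ->
  (forall j, (0 < j)%N -> `|D j| <= delta) ->
  (1 - beta) ^+ 2 * \sum_(1 <= j < N.+1) h j ^+ 2 <=
  4 * (`|a| * m + delta) ^+ 2 * beta.
Proof.
move=> m0 beta0 beta5 b_beta hrec delta0 Ddelta; set A := `|a| * m + delta.
set H := \sum_(1 <= j < _) _.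
have b1 : 0 < 1 - beta by lra.
have step j : (0 < j)%N -> (1 - beta) * h j ^+ 2 <=
    4 * A ^+ 2 * b j ^+ 2 +
    (1 - beta) * \sum_(1 <= i < j) b i ^+ 2 * h (j - i)%N ^+ 2.
  case: j => // j _.
  have w2 : (a * m + D j.+1) ^+ 2 <= A ^+ 2.
    rewrite -real_normK ?num_real// lerXn2r ?nnegrE ?addr_ge0 ?mulr_ge0 ?(ltW m0)//.
    by rewrite (le_trans (ler_normD _ _))// lerD ?Ddelta// normrM (gtr0_norm m0).
  rewrite hrec//; set x := 2 * _ * _; set y := \sum_(1 <= i < _) _.
  set z := \sum_(1 <= i < _) _.
  have x2 : x ^+ 2 <= 4 * A ^+ 2 * b j.+1 ^+ 2.
    rewrite (_ : x ^+ 2 = 4 * b j.+1 ^+ 2 * (a * m + D j.+1) ^+ 2); last by rewrite /x; ring.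
    rewrite [leRHS]mulrAC; apply: ler_wpM2l => //.
    by apply: mulr_ge0 => //; exact: sqr_ge0.
  have z0 : 0 <= z by apply: sumr_ge0 => i _; rewrite mulr_ge0 ?sqr_ge0.
  have yz : y ^+ 2 <= beta * z.
    (* Giving one factor b_i to each side of Cauchy-Schwarz leaves a sum of b_i^2 h_(j-i)^2, again a
       convolution. *)
    have -> : y = \sum_(1 <= i < j.+1) b i * (b i * h (j.+1 - i)%N).
      by apply: eq_bigr => i _; ring.
    have -> : z = \sum_(1 <= i < j.+1) (b i * h (j.+1 - i)%N) ^+ 2.
      by apply: eq_bigr => i _; ring.
    apply: le_trans (Cauchy_Schwarz_sum _ _ _ _) _.
    by rewrite ler_wpM2r// sumr_ge0// => i _; exact: sqr_ge0.
  (* Weighted form of (x + y)^2 <= x^2 / (1 - beta) + y^2 / beta, with weights chosen so that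
     nothing is lost against Minkowski. *)
  apply: (@le_trans _ _ (x ^+ 2 + (1 - beta) * z)); last by rewrite lerD2r.
  rewrite -(ler_pM2l beta0) -subr_ge0.
  have -> : beta * (x ^+ 2 + (1 - beta) * z) - beta * ((1 - beta) * (x + y) ^+ 2) =
    (1 - beta) * (beta * z - y ^+ 2) + ((1 - beta) * y - beta * x) ^+ 2 by ring.
  by rewrite addr_ge0 ?sqr_ge0// mulr_ge0 ?subr_ge0// ltW// -subr_gt0.
have sumstep : (1 - beta) * H <= 4 * A ^+ 2 * beta + (1 - beta) * (beta * H).
  rewrite /H mulr_sumr.
  apply: (@le_trans _ _ (\sum_(1 <= j < N.+1) (4 * A ^+ 2 * b j ^+ 2 +
    (1 - beta) * \sum_(1 <= i < j) b i ^+ 2 * h (j - i)%N ^+ 2))).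
    by apply: ler_sum_nat => j /andP[j1 _]; exact: step.
  rewrite big_split/= -!mulr_sumr lerD//.
    by rewrite ler_wpM2l// mulr_ge0 ?sqr_ge0.
  rewrite ler_wpM2l ?(ltW b1)//.
  have := @le_sum_convolution (fun i => b i ^+ 2) (fun i => h i ^+ 2) N
    (fun i => sqr_ge0 _) (fun i => sqr_ge0 _).
  move=> /le_trans; apply; rewrite ler_wpM2r//.
  by apply: sumr_ge0 => i _; exact: sqr_ge0.
have := sumstep; rewrite expr2; nra.
Qed.

(** Cauchy-Schwarz gives D_j^2 <= beta ||h||^2, and the bound on ||h|| supplies a second factor
    beta. The estimate is made on partial sums, since D_j is known only as a limit. *)
Lemma D_contraction (b h D : nat -> R) (a m beta : R) delta :
  0 < m -> 0 < beta -> 5 * beta < 1 ->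
  (forall N, \sum_(1 <= i < N.+1) b i ^+ 2 <= beta) ->
  (forall j, (0 < j)%N ->
    h j = 2 * b j * (a * m + D j) +
          \sum_(1 <= i < j) b i ^+ 2 * h (j - i)%N) ->
  (forall j, (0 < j)%N ->
    \sum_(j.+1 <= i < n.+1) b i * h (i - j)%N @[n --> \oo] --> D j) ->
  0 <= delta ->
  (forall j, (0 < j)%N -> `|D j| <= delta) ->
  forall j, (0 < j)%N -> (1 - beta) * `|D j| <= 2 * beta * (`|a| * m + delta).
Proof.
move=> m0 beta0 beta5 b_beta hrec Dlim delta0 Ddelta j j0.
have b1 : 0 < 1 - beta by lra.
have A0 : 0 <= `|a| * m + delta by rewrite addr_ge0// mulr_ge0// ltW.
rewrite mulrC -ler_pdivlMr//.
have cD : `|\sum_(j.+1 <= i < n.+1) b i * h (i - j)%N| @[n --> \oo] --> `|D j|.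
  by apply: cvg_norm; exact: Dlim.
rewrite -(cvg_lim _ cD)//; apply: limr_le; first by apply/cvg_ex; exists `|D j|.
apply: nearW => n.
rewrite -(ler_pXn2r (n := 2))// ?nnegrE//; last first.
  by rewrite divr_ge0 ?(ltW b1)// mulr_ge0// mulr_ge0// ltW.
rewrite real_normK ?num_real//.
apply: le_trans (Cauchy_Schwarz_sum _ _ _ _) _.
have B1 : \sum_(j.+1 <= i < n.+1) b i ^+ 2 <= beta.
  have [jn|nj] := leqP j n; last by rewrite big_geq ?ltnS ?(ltnW nj)// ltW.
  apply: le_trans (b_beta n); rewrite [leRHS](big_cat_nat (n := j.+1))//=.
  by rewrite lerDr; apply: sumr_ge0 => i _; exact: sqr_ge0.
have H1 : (1 - beta) ^+ 2 * \sum_(j.+1 <= i < n.+1) h (i - j)%N ^+ 2 <=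
    4 * (`|a| * m + delta) ^+ 2 * beta.
  have [jn|nj] := leqP j n; last first.
    by rewrite big_geq ?ltnS ?(ltnW nj)// mulr0 mulr_ge0 ?(ltW beta0)// mulr_ge0// sqr_ge0.
  rewrite -[j.+1]add1n big_addn subSn//.
  under eq_bigr do rewrite addnK.
  exact: (sum_h_sqr_le b h D).
have H0 : 0 <= \sum_(j.+1 <= i < n.+1) h (i - j)%N ^+ 2.
  by apply: sumr_ge0 => i _; exact: sqr_ge0.
apply: (@le_trans _ _ (beta * \sum_(j.+1 <= i < n.+1) h (i - j)%N ^+ 2)).
  by rewrite ler_wpM2r.
rewrite expr_div_n ler_pdivlMr ?exprn_gt0//.
apply: (@le_trans _ _ (beta * (4 * (`|a| * m + delta) ^+ 2 * beta))).
  have := ler_wpM2l (ltW beta0) H1; apply: le_trans.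
  by rewrite le_eqVlt; apply/orP; left; apply/eqP; ring.
by rewrite le_eqVlt; apply/orP; left; apply/eqP; ring.
Qed.

(** The a priori bound [K] makes the supremum of the |D_j| finite, so that it can be fed back into
    the contraction; the conclusion no longer depends on [K]. *)
Lemma D_lt (b h D : nat -> R) (a m beta : R) K :
  0 < m -> 0 < beta -> 5 * beta < 1 ->
  (forall N, \sum_(1 <= i < N.+1) b i ^+ 2 <= beta) ->
  (forall j, (0 < j)%N ->
    h j = 2 * b j * (a * m + D j) +
          \sum_(1 <= i < j) b i ^+ 2 * h (j - i)%N) ->
  (forall j, (0 < j)%N ->
    \sum_(j.+1 <= i < n.+1) b i * h (i - j)%N @[n --> \oo] --> D j) ->
  a != 0 -> (forall j, (0 < j)%N -> `|D j| <= K) ->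
  forall j, (0 < j)%N -> `|D j| < `|a| * m.
Proof.
move=> m0 beta0 beta5 b_beta hrec Dlim a0 DK j j0.
have b1 : 0 < 1 - beta by lra.
have A0 : 0 < `|a| * m by rewrite mulr_gt0// normr_gt0.
pose E := [set `|D i| | i in [set i | (0 < i)%N]].
have Esup : has_sup E.
  by split; [exists `|D j|; exists j|exists K => _ [i /= i0 <-]; exact: DK].
have Eub i : (0 < i)%N -> `|D i| <= sup E.
  by move=> i0; apply: sup_upper_bound => //; exists i.
have E0 : 0 <= sup E by apply: le_trans (Eub j j0).
have : sup E <= 2 * beta * (`|a| * m + sup E) / (1 - beta).
  apply: ge_sup; first by exists `|D j|; exists j.
  move=> _ [i /= i0 <-]; rewrite ler_pdivlMr// mulrC.
  exact: (D_contraction b h D).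
(* Now (1 - 3 beta) sup E <= 2 beta |a| m, and 2 beta < 1 - 3 beta is exactly 5 beta < 1. *)
rewrite ler_pdivlMr// => Ele.
apply: le_lt_trans (Eub j j0) _; nra.
Qed.

End recursion.

Lemma recursion_sign {R : realType} (b h D : nat -> R) (a m : R) (k : option nat) :
  0 < m ->
  (forall j, (0 < j)%N -> `|D j| < `|a| * m) ->
  (forall j, (0 < j)%N ->
    h j = 2 * b j * (a * m + D j) + \sum_(1 <= i < j) b i ^+ 2 * h (j - i)%N) ->
  a * b 1%N < 0 -> (forall j, (2 <= j)%N -> upto k j -> a * b j <= 0) ->
  forall j, (0 < j)%N -> upto k j -> h j < 0.
Proof.
move=> m0 Dlt hrec ab1 abj.
have aw j : (0 < j)%N -> 0 < a * (a * m + D j).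
  move=> j0; have := Dlt j j0.
  have [a0|a0|->] := ltgtP a 0.
  - rewrite (ltr0_norm a0) ltr_norml => /andP[_ Dj]; rewrite nmulr_rgt0//; lra.
  - rewrite (gtr0_norm a0) ltr_norml => /andP[Dj _]; rewrite pmulr_rgt0//; lra.
  - by rewrite normr0 mul0r ltNge normr_ge0.
elim/ltn_ind => -[|[|j]] IH // _ jk.
  rewrite hrec// big_geq// addr0.
  have := aw 1%N isT; nra.
have up i : (i < j.+2)%N -> upto k i.
  by move: jk; case: (k) => //= n jn ij; exact: leq_trans (ltnW ij) jn.
have hlt i : (0 < i)%N -> (i < j.+2)%N -> h (j.+2 - i)%N < 0.
  move=> i0 ij; apply: IH; [|by rewrite subn_gt0|].
    by rewrite ltn_subrL i0.
  by apply: up; rewrite ltn_subrL i0.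
(* Beyond the first lag a b_j may vanish, so strictness has to come from the term i = 1, where b_1
   is nonzero and h_(j-1) is already negative. *)
rewrite hrec// big_nat_recl//=.
have b1 : 0 < b 1%N ^+ 2.
  by rewrite exprn_even_gt0//=; apply: contraTneq ab1 => ->; rewrite mulr0 ltxx.
have t1 : b 1%N ^+ 2 * h (j.+2 - 1)%N < 0 by rewrite pmulr_rlt0// hlt.
have t2 : \sum_(1 <= i < j.+1) b i.+1 ^+ 2 * h (j.+2 - i.+1)%N <= 0.
  rewrite big_nat_cond; apply: sumr_le0 => i; rewrite andbT => /andP[i1 ij].
  by rewrite mulr_ge0_le0 ?sqr_ge0// ltW// hlt.
have t3 : 2 * b j.+2 * (a * m + D j.+2) <= 0.
  have a2 : 0 < a ^+ 2.
    by rewrite exprn_even_gt0//=; apply: contraTneq ab1 => ->; rewrite mul0r ltxx.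
  rewrite -(pmulr_rle0 _ a2).
  (* Multiplying by a^2 exposes a b_j and a (a m + D_j), whose signs are known whatever the sign of
     a. *)
  have -> : a ^+ 2 * (2 * b j.+2 * (a * m + D j.+2)) =
    2 * ((a * b j.+2) * (a * (a * m + D j.+2))) by ring.
  by rewrite pmulr_rle0// pmulr_lle0 ?abj// aw.
lra.
Qed.

(** * The process *)

Section process.
Context {d : measure_display} {T : measurableType d} {R : realType}.
Variables (P : probability T R) (zeta r S : int -> T -> R) (a c : R)
  (b : nat -> R).
Hypothesis mzeta : forall t, measurable_fun setT (zeta t).
Hypothesis ind : mutually_independent P zeta.
Hypothesis L3zeta : forall t, L3 P (zeta t).
Hypothesis zeta1 : forall t, \int[P]_x zeta t x = 0.
Hypothesis zeta2 : forall t, \int[P]_x (zeta t x ^+ 2) = 1.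
Hypothesis zeta3 : forall t, \int[P]_x (zeta t x ^+ 3) = 0.
Hypothesis adr : adapted zeta r.
Hypothesis L3r : forall t, L3 P (r t).
Hypothesis mS : forall t, measurable_fun setT (S t).
Hypothesis cvgS : forall t,
  ((fun n => \int[P]_x (((psum b r t n x - S t x) ^+ 2)%R)%:E)
     @ \oo --> (0 : \bar R))%E.
Hypothesis eqr : forall t,
  {ae P, forall x, r t x = zeta t x * sigma_of a c S t x}.

Let past t X := ae_past P zeta t X.
Let sg t := sigma_of a c S t.
Let tail t n x := S t x - psum b r t n x.

Let past_r s t : s <= t -> past t (r s).
Proof.
by move=> st; apply: ae_past_le st _; apply: adapted_ae_past => //; case: (L3r s).
Qed.

Lemma psumS t n x : psum b r t n.+1 x = psum b r t n x + b n.+1 * r (t - n.+1%:Z) x.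
Proof. by rewrite /psum big_nat_recr. Qed.

Lemma psum0 t x : psum b r t 0 x = 0.
Proof. by rewrite /psum big_geq. Qed.

Lemma L3_psum t n : L3 P (psum b r t n).
Proof.
elim: n => [|n IH].
  rewrite (_ : psum b r t 0 = fun=> 0); first exact: L3_cst.
  by apply/funext => x; rewrite psum0.
rewrite (_ : psum b r t n.+1 = fun x => psum b r t n x + b n.+1 * r (t - n.+1%:Z) x).
  by apply: L3D => //; exact: L3Z.
by apply/funext => x; rewrite psumS.
Qed.

(** The tail is the L^2 limit of differences of partial sums, which involve only lags from n + 1
    on. *)
Lemma past_tail t n : past (t - n.+1%:Z) (tail t n).
Proof.
apply: (L2_cvg_past _ _ _ (fun m x => psum b r t (m + n) x - psum b r t n x)).
- apply: measurable_funB; first exact: mS.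
  by case: (L3_psum t n).
- elim=> [|m IH].
    rewrite (_ : (fun _ => _) = fun=> 0); first exact: ae_past_cst.
    by apply/funext => x; rewrite add0n subrr.
  rewrite (_ : (fun _ => _) = fun x => (psum b r t (m + n) x - psum b r t n x)
      + b (m + n).+1 * r (t - (m + n).+1%:Z) x).
    apply: ae_pastD => //; apply: ae_pastM; first exact: ae_past_cst.
    by apply: past_r; rewrite lerD2l lerN2 lez_nat ltnS leq_addl.
  by apply/funext => x; rewrite addSn psumS addrAC.
- have := cvgS t; rewrite -(cvg_shiftn n); apply: cvg_trans.
  apply: near_eq_cvg; apply: nearW => m.
  by apply: eq_integral => x _; rewrite /tail opprB addrA subrK.
Qed.

Lemma past_S t : past (t - 1) (S t).
Proof.
have := past_tail t 0; rewrite (_ : tail t 0 = S t)//.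
by apply/funext => x; rewrite /tail psum0 subr0.
Qed.

Lemma measurable_sqrtr : measurable_fun setT (@Num.sqrt R).
Proof. by apply: continuous_measurable_fun; exact: sqrt_continuous. Qed.

Lemma past_sg t : past (t - 1) (sg t).
Proof.
apply: (ae_past_comp _ _ _ _ _ measurable_sqrtr).
apply: ae_pastD; first exact: ae_past_cst.
have paS : past (t - 1) (fun x => a + S t x).
  by apply: ae_pastD; [exact: ae_past_cst|exact: past_S].
exact: (ae_pastM _ _ _ _ _ paS paS).
Qed.

Lemma sg_sqr t x : sg t x ^+ 2 = c ^+ 2 + (a + S t x) ^+ 2.
Proof. by rewrite /sg /sigma_of sqr_sqrtr// addr_ge0 ?sqr_ge0. Qed.

Lemma sg_ge0 t x : 0 <= sg t x.
Proof. exact: sqrtr_ge0. Qed.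

(** By independence E|r_t|^3 = E|zeta_t|^3 E|sigma_t|^3 in the extended reals. The left side is
    finite and E|zeta_t|^3 is positive, so the last factor is finite. *)
Lemma L3_sg t : L3 P (sg t).
Proof.
have [msg _] := past_sg t; split=> //.
have mz := mzeta t.
have m3 : measurable_fun setT (fun y : R => `|y| ^+ 3).
  by apply: measurable_funX; exact: normr_measurable.
apply/integrableP; split; first exact/measurable_EFinP/measurable_funX/measurableT_comp.
under eq_integral do rewrite abse_EFin normrX normr_id.
have := @ge0_integral_zeta_past _ _ _ P zeta mzeta ind t (fun y => `|y| ^+ 3)
  (fun x => `|sg t x| ^+ 3) m3.
have -> : (\int[P]_x (`|zeta t x| ^+ 3 * `|sg t x| ^+ 3)%:E =
    \int[P]_x (`|r t x| ^+ 3)%:E)%E.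
  apply: ae_eq_integral => //.
  - by apply/measurable_EFinP/measurable_funM; exact/measurable_funX/measurableT_comp.
  - by apply/measurable_EFinP/measurable_funX/measurableT_comp => //; case: (L3r t).
  - by apply: filterS (eqr t) => x -> _; rewrite normrM exprMn.
move=> /(_ (fun y => exprn_ge0 _ (normr_ge0 _))).
move=> /(_ (fun y => exprn_ge0 _ (normr_ge0 _))).
move=> /(_ (ae_past_comp _ _ _ _ _ m3 (past_sg t))) E.
have [_ /(integrable_lty measurableT)] := L3r t; rewrite E.
have [_ iz] := L3zeta t.
(* Otherwise zeta_t = 0 almost surely, against E zeta_t^2 = 1. *)
have z0 : (\int[P]_x (`|zeta t x| ^+ 3)%:E != 0)%E.
  apply/eqP => z30.
  have := zeta2 t; rewrite (ae_eq_Rintegral P _ (fun=> 0)).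
  - by rewrite Rintegral_cst_probability => /eqP; rewrite eq_sym oner_eq0.
  - exact: measurable_funX.
  - by [].
  - have /ae_eq_integral_abs : measurable_fun setT (fun x => (`|zeta t x| ^+ 3)%:E).
      exact/measurable_EFinP/measurable_funX/measurableT_comp.
    move=> /(_ P measurableT)[+ _].
    under eq_integral do rewrite abse_EFin normrX normr_id.
    move=> /(_ z30); apply: filterS => x /(_ I) [] /eqP.
    by rewrite expf_eq0 normr_eq0 => /eqP ->; rewrite expr0n.
have zge0 : (0 <= \int[P]_x (`|zeta t x| ^+ 3)%:E)%E.
  by apply: integral_ge0 => x _; rewrite lee_fin exprn_ge0.
rewrite muleC; move: z0 zge0 (integrable_fin_num measurableT iz).
move: (\int[P]_x (`|zeta t x| ^+ 3)%:E)%E => [q| |]//.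
rewrite eqe lee_fin => q0 qge0 _; case: (\int[P]_x _)%E => [p| |]//.
  by move=> _; rewrite ltry.
by rewrite gt0_mulye// lte_fin lt_neqAle eq_sym q0.
Qed.

(** Since sigma_t >= |a + S_t|, the bound |S_t| <= |a| + sigma_t holds pointwise. *)
Lemma L3_S t : L3 P (S t).
Proof.
apply: (le_L3 P _ (fun x => `|a| + sg t x)) => //; last first.
  by apply: L3D; [exact: L3_cst|exact: L3_sg].
move=> x; rewrite [leRHS]ger0_norm ?addr_ge0 ?sg_ge0//.
rewrite -[X in `|X|](addKr a) (le_trans (ler_normD _ _))// normrN lerD2l.
by rewrite -sqrtr_sqr ler_wsqrtr// lerDr sqr_ge0.
Qed.

Lemma L3_aS t : L3 P (fun x => a + S t x).
Proof. by apply: L3D; [exact: L3_cst|exact: L3_S]. Qed.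

Lemma L3_tail t n : L3 P (tail t n).
Proof.
rewrite (_ : tail t n = fun x => S t x + (-1) * psum b r t n x).
  by apply: L3D; [exact: L3_S|apply: L3Z; exact: L3_psum].
by apply/funext => x; rewrite /tail mulN1r.
Qed.

Lemma Rintegral_r_past t (X : T -> R) (f : R -> R) (W : T -> R) :
  measurable_fun setT f -> P.-integrable setT (fun x => (f (zeta t x))%:E) ->
  past (t - 1) W -> P.-integrable setT (fun x => (W x)%:E) ->
  measurable_fun setT X ->
  {ae P, forall x, X x = f (zeta t x) * W x} ->
  \int[P]_x X x = \int[P]_x f (zeta t x) * \int[P]_x W x.
Proof.
move=> mf iz pW iW mX XE.
rewrite (ae_eq_Rintegral P X (fun x => f (zeta t x) * W x))//.
  exact: (Rintegral_zeta_past P zeta mzeta ind t f W mf iz iW pW).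
by apply: measurable_funM; [exact: measurableT_comp|case: pW].
Qed.

Let mr t : measurable_fun setT (r t). Proof. by case: (L3r t). Qed.

Lemma E3_r_past t X Y : past (t - 1) X -> past (t - 1) Y ->
  L3 P X -> L3 P Y -> E3 P (r t) X Y = 0.
Proof.
move=> pX pY LX LY; have [mX _] := LX; have [mY _] := LY.
rewrite /E3 (Rintegral_r_past t _ id (fun x => sg t x * X x * Y x)) ?zeta1 ?mul0r//.
- exact: (L3_integrable P).
- exact: (ae_pastM _ _ _ _ _ (ae_pastM _ _ _ _ _ (past_sg t) pX) pY).
- exact: (L3_integrableM P _ _ _ (L3_sg t) LX LY).
- by apply: measurable_funM => //; exact: measurable_funM.
- by apply: filterS (eqr t) => x ->; rewrite /sg !mulrA.
Qed.

Lemma E3_rr_past t X : past (t - 1) X -> L3 P X ->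
  E3 P (r t) (r t) X = E3 P (sg t) (sg t) X.
Proof.
move=> pX LX; have [mX _] := LX.
rewrite /E3 (Rintegral_r_past t _ (fun y => y ^+ 2) (fun x => sg t x * sg t x * X x)).
- by rewrite zeta2 mul1r.
- exact: exprn_measurable.
- have := L3_integrableM P _ _ _ (L3zeta t) (L3zeta t) (L3_cst P 1).
  by under eq_fun do rewrite mulr1 -expr2.
- exact: (ae_pastM _ _ _ _ _ (ae_pastM _ _ _ _ _ (past_sg t) (past_sg t)) pX).
- exact: (L3_integrableM P _ _ _ (L3_sg t) (L3_sg t) LX).
- by apply: measurable_funM => //; exact: measurable_funM.
- by apply: filterS (eqr t) => x ->; rewrite /sg; ring.
Qed.

Lemma E3_rrr t : E3 P (r t) (r t) (r t) = 0.
Proof.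
rewrite /E3 (Rintegral_r_past t _ (fun y => y ^+ 3) (fun x => sg t x * sg t x * sg t x)).
- by rewrite zeta3 mul0r.
- exact: exprn_measurable.
- have := L3_integrableM P _ _ _ (L3zeta t) (L3zeta t) (L3zeta t).
  by under eq_fun do rewrite -expr2 -exprSr.
- exact: (ae_pastM _ _ _ _ _ (ae_pastM _ _ _ _ _ (past_sg t) (past_sg t)) (past_sg t)).
- exact: (L3_integrableM P _ _ _ (L3_sg t) (L3_sg t) (L3_sg t)).
- by apply: measurable_funM => //; exact: measurable_funM.
- by apply: filterS (eqr t) => x ->; rewrite /sg; ring.
Qed.

Lemma E3_psum t n X Y : L3 P X -> L3 P Y ->
  E3 P (psum b r t n) X Y = \sum_(1 <= j < n.+1) b j * E3 P (r (t - j%:Z)) X Y.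
Proof.
move=> LX LY; elim: n => [|n IH].
  rewrite big_geq// /E3 (@eq_Rintegral _ _ _ P setT (fun=> 0)).
    by rewrite Rintegral_cst_probability.
  by move=> x _; rewrite psum0 !mul0r.
rewrite big_nat_recr//= -IH -E3Z// -E3D//; last exact: L3Z.
  by congr E3; apply/funext => x; exact: psumS.
exact: L3_psum.
Qed.

(** Every r_(t-i) with i <= n < j is strictly later than X and Y and occurs once, so E zeta = 0
    removes each term. *)
Lemma E3_psum_past t j n X Y : (n < j)%N -> past (t - j%:Z) X ->
  past (t - j%:Z) Y -> L3 P X -> L3 P Y -> E3 P (psum b r t n) X Y = 0.
Proof.
move=> nj pX pY LX LY; rewrite E3_psum// big_nat_cond big1// => i.
rewrite andbT => /andP[i1 iN].
have ij : t - j%:Z <= t - i%:Z - 1.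
  rewrite -addrA -opprD lerD2l lerN2 -PoszD lez_nat addn1.
  exact: leq_trans iN nj.
by rewrite E3_r_past ?mulr0//; [move: pX|move: pY]; exact: ae_past_le.
Qed.

(** Off the diagonal, the factor with the smaller lag is strictly the latest and occurs once, so
    only the squares survive. *)
Lemma E3_psum_sqr t j n : (n < j)%N ->
  E3 P (psum b r t n) (psum b r t n) (r (t - j%:Z)) =
  \sum_(1 <= i < n.+1) b i ^+ 2 * E3 P (r (t - i%:Z)) (r (t - i%:Z)) (r (t - j%:Z)).
Proof.
elim: n => [|n IH] nj.
  by rewrite big_geq// E3_psum ?big_geq//; exact: L3_psum.
rewrite big_nat_recr//= -IH; last exact: ltnW.
set i := n.+1; set ri := r (t - i%:Z); set rj := r (t - j%:Z).
set U := psum b r t n.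
have LU : L3 P U by exact: L3_psum.
have Lri : L3 P ri by exact: L3r.
have Lrj : L3 P rj by exact: L3r.
have Lbi : L3 P (fun x => b i * ri x) by exact: L3Z.
have UE : psum b r t i = fun x => U x + b i * ri x.
  by apply/funext => x; exact: psumS.
have pj : past (t - i%:Z) rj by apply: past_r; rewrite lerD2l lerN2 lez_nat ltnW.
have cross : E3 P ri U rj = 0.
  rewrite E3C12; apply: (E3_psum_past t i n) => //.
  exact: past_r.
rewrite UE E3_sqrD// (E3C12 P U) E3Z// cross !mulr0 addr0; congr (_ + _).
by rewrite E3Z// E3C12 E3Z//; ring.
Qed.

(* |y + z|^3 >= |z|^3 + 3 z |z| y by convexity, and the partial sum y is orthogonal
   to every function of the tail z. *)
Lemma integral_norm3_tail_le t n :
  \int[P]_x `|tail t n x| ^+ 3 <= \int[P]_x `|S t x| ^+ 3.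
Proof.
have LX := L3_tail t n; have LU := L3_psum t n; have LS := L3_S t.
have LaX : L3 P (fun x => `|tail t n x|).
  apply: (le_L3 P _ (tail t n)) => // [|x]; last by rewrite normr_id.
  by apply: measurableT_comp => //; case: LX.
have pX := past_tail t n.
have cross : E3 P (psum b r t n) (fun x => `|tail t n x|) (tail t n) = 0.
  apply: (E3_psum_past t n.+1 n) => //.
  apply: (ae_past_comp P zeta _ (fun y => `|y|) (tail t n) _ pX).
  exact: normr_measurable.
have iX3 : P.-integrable setT (fun x => (`|tail t n x| ^+ 3)%:E) by case: LX.
have i1 := L3_integrableM P _ _ _ LU LaX LX.
have i2 : P.-integrable setT
    (fun x => (3 * (psum b r t n x * `|tail t n x| * tail t n x))%:E).
  exact: integrable_EFinZ.
have -> : \int[P]_x `|tail t n x| ^+ 3 = \int[P]_x (`|tail t n x| ^+ 3 +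
    3 * (psum b r t n x * `|tail t n x| * tail t n x)).
  rewrite RintegralD// RintegralZl//.
  by move: cross; rewrite /E3 => ->; rewrite mulr0 addr0.
apply: le_Rintegral => //; first exact: integrable_EFinD.
  by case: LS.
move=> x _; have -> : S t x = psum b r t n x + tail t n x by rewrite /tail addrC subrK.
move: (psum b r t n x) (tail t n x) => y z.
have [z0|z0] := leP 0 z; have [yz0|yz0] := leP 0 (y + z).
- rewrite (ger0_norm z0) (ger0_norm yz0).
  have : 0 <= y ^+ 2 * ((y + z) + 2 * z) by rewrite mulr_ge0 ?sqr_ge0; lra.
  lra.
- rewrite (ger0_norm z0) (ltr0_norm yz0).
  have : 0 <= (- (y + z)) ^+ 3 by rewrite exprn_ge0; lra.
  have : 0 <= z ^+ 2 * (- (y + z)) by rewrite mulr_ge0 ?sqr_ge0; lra.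
  have : 0 <= z ^+ 3 by rewrite exprn_ge0.
  lra.
- rewrite (ltr0_norm z0) (ger0_norm yz0).
  have : 0 <= (y + z) ^+ 3 by rewrite exprn_ge0.
  have : 0 <= z ^+ 2 * (y + z) by rewrite mulr_ge0 ?sqr_ge0.
  have : 0 <= (- z) ^+ 3 by rewrite exprn_ge0; lra.
  lra.
- rewrite (ltr0_norm z0) (ltr0_norm yz0).
  have : 0 <= y ^+ 2 * (- (y + z) - 2 * z) by rewrite mulr_ge0 ?sqr_ge0; lra.
  lra.
Qed.

Lemma E3_recursion t j : (0 < j)%N ->
  E3 P (r t) (r t) (r (t - j%:Z)) =
  2 * b j * (a * E3 P (r (t - j%:Z)) (r (t - j%:Z)) (fun=> 1) +
             E3 P (r (t - j%:Z)) (r (t - j%:Z)) (tail t j)) +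
  \sum_(1 <= i < j) b i ^+ 2 * E3 P (r (t - i%:Z)) (r (t - i%:Z)) (r (t - j%:Z)).
Proof.
case: j => // n _; set j := n.+1; set s := t - j%:Z.
have Lr := L3r s.
have L1 : L3 P (fun=> 1 : R) by exact: L3_cst.
have LA := L3_aS t; have LX := L3_tail t j; have LU := L3_psum t n.
have p1 u : past u (fun=> 1 : R) by exact: ae_past_cst.
have ps : past (t - 1) (r s) by apply: past_r; rewrite lerD2l lerN2.
have psX : past (s - 1) (tail t j).
  by rewrite -addrA -opprD -PoszD addn1; exact: past_tail.
(* a + S_t is the sum of the lags below j, namely [psum b r t n] as j = n + 1, and of [Q], which is
   measurable at time s. In [Q], the part [V] lies strictly before s. *)
pose V x := a + tail t j x; pose Q x := b j * r s x + V x.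
have LV : L3 P V by apply: L3D => //; exact: L3_cst.
have Lb : L3 P (fun x => b j * r s x) by exact: L3Z.
have LQ : L3 P Q by exact: L3D.
have pV : past (s - 1) V by apply: ae_pastD => //; exact: ae_past_cst.
have pQ : past s Q.
  apply: ae_pastD; last by apply: ae_past_le pV; rewrite gerDl.
  by apply: ae_pastM; [exact: ae_past_cst|exact: past_r].
have rVV : E3 P V V (r s) = 0 by rewrite E3C23 E3C12 E3_r_past.
have UQr : E3 P (psum b r t n) Q (r s) = 0.
  by apply: (E3_psum_past t j n) => //; exact: past_r.
have EQQ : E3 P Q Q (r s) = 2 * b j * E3 P (r s) (r s) V.
  rewrite /Q E3_sqrD// rVV E3Z// E3C12 E3Z// E3_rrr (E3Z P _ (r s) V)//.
  by rewrite (E3C23 P (r s) V); ring.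
have EUU : E3 P (fun x => a + S t x) (fun x => a + S t x) (r s) =
    E3 P (psum b r t n) (psum b r t n) (r s) + E3 P Q Q (r s).
  have -> : (fun x => a + S t x) = (fun x => psum b r t n x + Q x).
    by apply/funext => x; rewrite /Q /V /tail psumS /j -/s; ring.
  by rewrite E3_sqrD// UQr mulr0 addr0.
have EV : E3 P (r s) (r s) V =
    a * E3 P (r s) (r s) (fun=> 1) + E3 P (r s) (r s) (tail t j).
  rewrite addrC -E3DZr//; congr E3; apply/funext => x.
  by rewrite /V mulr1 addrC.
rewrite E3_rr_past//.
have -> : E3 P (sg t) (sg t) (r s) =
    E3 P (fun x => a + S t x) (fun x => a + S t x) (r s).
  (* Replacing sigma_t^2 by (a + S_t)^2 drops the term c^2 E r_s, which is zero. *)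
  have E0 : \int[P]_x r s x = 0.
    have := E3_r_past s _ _ (p1 _) (p1 _) L1 L1.
    by rewrite /E3 (@eq_Rintegral _ _ _ P setT (r s))// => x _; rewrite !mulr1.
  rewrite /E3; transitivity (\int[P]_x (c ^+ 2 * r s x +
      (a + S t x) * (a + S t x) * r s x)).
    by apply: eq_Rintegral => x _; rewrite -expr2 sg_sqr expr2; ring.
  have ir := L3_integrable P _ Lr.
  rewrite RintegralD//; last 2 first.
  - exact: integrable_EFinZ.
  - exact: (L3_integrableM P _ _ _ LA LA Lr).
  by rewrite RintegralZl// E0 mulr0 add0r.
by rewrite EUU EQQ EV E3_psum_sqr//; ring.
Qed.

Lemma E3_tail_cvg t X : L3 P X -> E3 P X X (tail t n) @[n --> \oo] --> (0 : R).
Proof.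
move=> LX; apply: (weak_cvg_E3 P X (tail t) (\int[P]_x `|S t x| ^+ 3)) => //.
- by move=> n; exact: L3_tail.
- by move=> n; exact: integral_norm3_tail_le.
- apply: cvg_trans (cvgS t); apply: near_eq_cvg; apply: nearW => n.
  by apply: eq_integral => x _; rewrite -sqrrN opprB.
Qed.

(** Consecutive tails differ by one term of the series, so the sum telescopes to the difference of
    two tail moments, and the second of these tends to 0. *)
Lemma E3_tail_series t j X : L3 P X ->
  \sum_(j.+1 <= i < n.+1) b i * E3 P X X (r (t - i%:Z)) @[n --> \oo]
    --> E3 P X X (tail t j).
Proof.
move=> LX.
have E n : (j <= n)%N -> \sum_(j.+1 <= i < n.+1) b i * E3 P X X (r (t - i%:Z)) =
    E3 P X X (tail t j) - E3 P X X (tail t n).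
  elim: n => [|n IH] jn.
    by move: jn; rewrite leqn0 => /eqP ->; rewrite big_geq// subrr.
  have [jn'|jn'] := leqP j n; last first.
    have -> : j = n.+1 by apply/eqP; rewrite eqn_leq jn.
    by rewrite big_geq// subrr.
  have LT := L3_tail t n.+1; have Lr := L3r (t - n.+1%:Z).
  rewrite big_nat_recr//= IH//.
  have -> : tail t n = (fun x => tail t n.+1 x + b n.+1 * r (t - n.+1%:Z) x).
    by apply/funext => x; rewrite /tail psumS; ring.
  by rewrite E3DZr//; ring.
rewrite -[X in _ --> X]subr0.
have : E3 P X X (tail t j) - E3 P X X (tail t n) @[n --> \oo] -->
    E3 P X X (tail t j) - (0 : R).
  by apply: cvgB; [exact: cvg_cst|exact: E3_tail_cvg].
apply: cvg_trans; apply: near_eq_cvg; exists j => // n /= jn.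
by rewrite E.
Qed.

(** Partial sums have mean zero, so every tail has the mean of S_t, while the means of the tails
    tend to 0. *)
Lemma Rintegral_S t : \int[P]_x S t x = 0.
Proof.
have L1 : L3 P (fun=> 1 : R) by exact: L3_cst.
have E n : E3 P (fun=> 1) (fun=> 1) (tail t n) = \int[P]_x S t x.
  have U0 : \int[P]_x psum b r t n x = 0.
    have <- : E3 P (psum b r t n) (fun=> 1) (fun=> 1) = 0.
      by apply: (E3_psum_past t n.+1 n) => //; exact: ae_past_cst.
    by apply: eq_Rintegral => x _; rewrite !mulr1.
  transitivity (\int[P]_x (S t x - psum b r t n x)).
    by apply: eq_Rintegral => x _; rewrite !mul1r.
  rewrite RintegralB ?U0 ?subr0//; apply: (L3_integrable P).
    exact: L3_S.
  exact: L3_psum.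
have := E3_tail_cvg t _ L1; under eq_fun do rewrite E.
by move=> /(cvg_unique (@norm_hausdorff _ _) (cvg_cst _)).
Qed.

(** Ensures m > 0 once a is nonzero. It holds because sigma_t^2 >= a^2 + 2 a S_t and E S_t = 0. *)
Lemma sqr_le_E3_rr1 t : a ^+ 2 <= E3 P (r t) (r t) (fun=> 1).
Proof.
have L1 : L3 P (fun=> 1 : R) by exact: L3_cst.
have LS := L3_S t.
rewrite E3_rr_past//; last exact: ae_past_cst.
have i1 : P.-integrable setT (fun x => (a ^+ 2 + 2 * a * S t x)%:E).
  apply: integrable_EFinD; first exact: finite_measure_integrable_cst.
  by apply: integrable_EFinZ; exact: L3_integrable.
apply: (@le_trans _ _ (\int[P]_x (a ^+ 2 + 2 * a * S t x))).
  rewrite RintegralD//; last 2 first.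
  - exact: finite_measure_integrable_cst.
  - by apply: integrable_EFinZ; exact: L3_integrable.
  rewrite Rintegral_cst_probability RintegralZl//; last exact: L3_integrable.
  by rewrite Rintegral_S mulr0 addr0.
apply: le_Rintegral => //; first exact: L3_integrableM (L3_sg t) (L3_sg t) L1.
move=> x _; rewrite mulr1 -expr2 sg_sqr.
have := sqr_ge0 c; have := sqr_ge0 (S t x); nra.
Qed.

End process.

(** * Shift invariance of the moments *)

Section stationarity.
Context {d : measure_display} {T : measurableType d} {R : realType}.
Variables (P : probability T R) (r : int -> T -> R).
Hypothesis mr : forall t, measurable_fun setT (r t).
Hypothesis statr : strictly_stationary P r.

Lemma E3_stationary t n : (0 < n)%N ->
  E3 P (r t) (r t) (r (t - n%:Z)) = E3 P (r 0) (r 0) (r (- n%:Z)).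
Proof.
move=> n0.
have mf : @measurable_fun _ _ _ (\bar R) [set: R * R] (fun z => (z.1 * z.1 * z.2)%:E).
  by apply/measurable_EFinP/measurable_funM => //; exact: measurable_funM.
have n0' : (0 : int) != - n%:Z by rewrite eq_sym oppr_eq0 eqz_nat -lt0n.
have := stationary_integral2 P r mr statr (fun z => (z.1 * z.1 * z.2)%:E)
  0 (- n%:Z) t mf n0'.
by rewrite add0r addrC => E; congr fine.
Qed.

Lemma E3_rr1_stationary t :
  E3 P (r t) (r t) (fun=> 1) = E3 P (r 0) (r 0) (fun=> 1).
Proof.
congr fine; apply: (stationary_integral1 P r mr statr (fun y => (y * y * 1)%:E)).
by apply/measurable_EFinP/measurable_funM => //; exact: measurable_funM.
Qed.

Lemma integral_norm3_stationary t :
  (\int[P]_x (`|r t x| ^+ 3)%:E = \int[P]_x (`|r 0 x| ^+ 3)%:E)%E.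
Proof.
apply: (stationary_integral1 P r mr statr (fun y => (`|y| ^+ 3)%:E)).
by apply/measurable_EFinP/measurable_funX; exact: normr_measurable.
Qed.

Lemma L3_stationary t : L3 P (r 0) -> L3 P (r t).
Proof.
move=> [_ /(integrable_lty measurableT)] r0; split=> //; apply/integrableP; split.
  exact/measurable_EFinP/measurable_funX/measurableT_comp.
under eq_integral do rewrite abse_EFin normrX normr_id.
by rewrite integral_norm3_stationary.
Qed.

End stationarity.

Lemma covariance_sqrE {d : measure_display} {T : measurableType d}
  {R : realType} (P : probability T R) (s X : T -> R) :
  L3 P s -> L3 P X -> \int[P]_x X x = 0 ->
  covariance P (fun x => s x ^+ 2) X = (E3 P s s X)%:E.
Proof.
move=> Ls LX X0.
have iss : P.-integrable setT (fun x => (s x ^+ 2)%:E).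
  have := L3_integrableM P _ _ _ Ls Ls (L3_cst P 1).
  by under eq_fun do rewrite mulr1 -expr2.
have iX := L3_integrable P X LX.
have issX := L3_integrableM P _ _ _ Ls Ls LX.
rewrite covarianceE; [|exact/Lfun1_integrable..].
have EX : ('E_P[X] = 0)%E.
  by rewrite unlock -[LHS]fineK ?integrable_fin_num// [fine _]X0.
rewrite EX mule0 sube0 unlock /E3 /Rintegral fineK ?integrable_fin_num//.
Qed.

Theorem theorem11 (d : measure_display) (T : measurableType d) (R : realType)
  (P : probability T R) (zeta r : int -> T -> R) (a c : R) (b : nat -> R)
  (S : int -> T -> R) (k : option nat) :
  (* i.i.d. innovations with the moment conditions *)
  (forall t, measurable_fun setT (zeta t)) ->
  mutually_independent P zeta ->
  identically_distributed P zeta ->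
  P.-integrable setT (fun x => (`|zeta 0 x| ^+ 3)%:E) ->
  ('E_P[zeta 0%R] = 0)%E ->
  ('E_P[fun x => (zeta 0 x ^+ 2)%R] = 1)%E ->
  ('E_P[fun x => (zeta 0 x ^+ 3)%R] = 0)%E ->
  (* parameters *)
  0 <= c ->
  (\sum_(1 <= j <oo) ((b j) ^+ 2)%:E < (5^-1)%:E)%E ->
  (* {r_t} is an adapted L^2 process *)
  (forall t, measurable_fun setT (r t)) ->
  adapted zeta r ->
  (forall t, P.-integrable setT (fun x => (r t x ^+ 2)%:E)) ->
  (* the series sum_{s<t} b_{t-s} r_s converges in L^2 to S_t *)
  (forall t, measurable_fun setT (S t)) ->
  (forall t, ((fun n => \int[P]_x (((psum b r t n x - S t x) ^+ 2)%R)%:E)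
               @ \oo --> (0 : \bar R))%E) ->
  (* the equation r_t = zeta_t sigma_t holds (a.s.) *)
  (forall t, {ae P, forall x, r t x = zeta t x * sigma_of a c S t x}) ->
  (* stationarity and third moment of r_0 *)
  strictly_stationary P r ->
  P.-integrable setT (fun x => (`|r 0 x| ^+ 3)%:E) ->
  (* 1 <= k <= infinity *)
  (forall n, k = Some n -> (1 <= n)%N) ->
  ((a * b 1%N < 0 /\ (forall j, (2 <= j)%N -> upto k j -> a * b j <= 0)) ->
     forall (t : int) (j : nat), (1 <= j)%N -> upto k j ->
       (covariance P (fun x => (sigma_of a c S t x ^+ 2)%R) (r (t - j%:Z)%R) < 0)%E)
  /\
  ((a * b 1%N > 0 /\ (forall j, (2 <= j)%N -> upto k j -> a * b j >= 0)) ->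
     forall (t : int) (j : nat), (1 <= j)%N -> upto k j ->
       (covariance P (fun x => (sigma_of a c S t x ^+ 2)%R) (r (t - j%:Z)%R) > 0)%E).
Proof.
move=> mz ind idz iz0 Ez1 Ez2 Ez3 _ b5 mr adr _ mS cvgS eqr statr ir0 _.
have L3r t : L3 P (r t) by apply: L3_stationary.
have L3z t : L3 P (zeta t).
  split=> //; apply/integrableP; split.
    exact/measurable_EFinP/measurable_funX/measurableT_comp.
  under eq_integral do rewrite abse_EFin normrX normr_id.
  rewrite (integral_zeta_stationary P zeta mz t (fun y => (`|y| ^+ 3)%:E))//.
    exact: integrable_lty.
  by apply/measurable_EFinP/measurable_funX; exact: normr_measurable.
have Ez n t v : ('E_P[fun x => (zeta 0 x ^+ n)%R] = v%:E)%E ->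
    \int[P]_x (zeta t x ^+ n) = v.
  rewrite unlock => En.
  have := integral_zeta_stationary P zeta mz t (fun y => (y ^+ n)%:E) idz.
  by rewrite /Rintegral => ->; rewrite ?En//; exact/measurable_EFinP.
have z1 t : \int[P]_x zeta t x = 0 by exact: (Ez 1%N t 0 Ez1).
have z2 t := Ez 2%N t 1 Ez2.
have z3 t := Ez 3%N t 0 Ez3.
pose h (n : nat) := E3 P (r 0) (r 0) (r (- n%:Z)).
pose m := E3 P (r 0) (r 0) (fun=> 1).
have hE t i j : (i < j)%N ->
    E3 P (r (t - i%:Z)) (r (t - i%:Z)) (r (t - j%:Z)) = h (j - i)%N.
  move=> ij; have -> : t - j%:Z = t - i%:Z - (j - i)%N%:Z.
    by rewrite -subzn ?(ltnW ij)// opprB addrA subrK.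
  by apply: E3_stationary => //; rewrite subn_gt0.
have L3s := L3_sg P zeta r S a c b mz ind L3z z2 adr L3r mS cvgS eqr.
have r1 t : \int[P]_x r t x = 0.
  have pc := ae_past_cst P zeta (t - 1) 1.
  have := E3_r_past P zeta r S a c b mz ind L3z z1 z2 adr L3r mS cvgS eqr
    t _ _ pc pc (L3_cst P 1) (L3_cst P 1).
  by move=> <-; apply: eq_Rintegral => x _; rewrite !mulr1.
have covE t j : (0 < j)%N ->
    covariance P (fun x => (sigma_of a c S t x ^+ 2)%R) (r (t - j%:Z)%R) = (h j)%:E.
  move=> j0; rewrite (covariance_sqrE P (sigma_of a c S t))//.
  rewrite -(E3_rr_past P zeta r S a c b mz ind L3z z2 adr L3r mS cvgS eqr)//.
    by rewrite E3_stationary.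
  apply: (ae_past_le P zeta (t - j%:Z)); first by rewrite lerD2l lerN2 lez_nat.
  exact: adapted_ae_past.
pose D j := E3 P (r (0 - j%:Z)) (r (0 - j%:Z)) (fun x => S 0 x - psum b r 0 j x).
have hrec j : (0 < j)%N ->
    h j = 2 * b j * (a * m + D j) + \sum_(1 <= i < j) b i ^+ 2 * h (j - i)%N.
  move=> j0; rewrite -[h j](E3_stationary P r mr statr 0)//.
  rewrite (E3_recursion P zeta r S a c b mz ind L3z z1 z2 z3 adr L3r mS cvgS eqr)//.
  rewrite (E3_rr1_stationary P r mr statr); congr (_ + _).
  by apply: eq_big_nat => i /andP[_ ij]; rewrite hE.
have Dlim j : (0 < j)%N ->
    \sum_(j.+1 <= i < n.+1) b i * h (i - j)%N @[n --> \oo] --> D j.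
  move=> j0.
  have := E3_tail_series P zeta r S a c b mz ind L3z z1 z2 adr L3r mS cvgS eqr
    0 j _ (L3r (0 - j%:Z)).
  apply: cvg_trans; apply: near_eq_cvg; apply: nearW => n.
  by apply: eq_big_nat => i /andP[ji _]; rewrite hE.
(* Both signs of a b_1 go through this: a nonzero a gives m > 0, and a nonzero b_1 gives [beta] >
   0. *)
have key : a * b 1%N != 0 -> 0 < m /\ forall j, (0 < j)%N -> `|D j| < `|a| * m.
  rewrite mulf_eq0 negb_or => /andP[a0 b10].
  have m0 : 0 < m.
    have := sqr_le_E3_rr1 P zeta r S a c b mz ind L3z z1 z2 adr L3r mS cvgS eqr 0.
    by apply: lt_le_trans; rewrite exprn_even_gt0.
  split=> //.
  have nnb i : (0 <= (b i ^+ 2)%:E)%E by rewrite lee_fin sqr_ge0.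
  have bfin : (\sum_(1 <= j <oo) (b j ^+ 2)%:E \is a fin_num)%E.
    by rewrite ge0_fin_numE ?nneseries_ge0// (lt_trans b5)// ltry.
  pose beta := fine (\sum_(1 <= j <oo) (b j ^+ 2)%:E)%E.
  have bN N : \sum_(1 <= i < N.+1) b i ^+ 2 <= beta.
    by rewrite -lee_fin fineK// -sumEFin; apply: nneseries_lim_ge.
  have beta0 : 0 < beta.
    by apply: lt_le_trans (bN 1%N); rewrite big_nat1 exprn_even_gt0.
  have beta5 : 5 * beta < 1.
    by rewrite mulrC -ltr_pdivlMr// mul1r -lte_fin fineK.
  (* The bound is uniform in j: stationarity handles the two factors r_(-j), and the tail is
     dominated in L^3 by S_0. *)
  apply: (D_lt b h D a m beta (\int[P]_x `|r 0 x| ^+ 3 + \int[P]_x `|r 0 x| ^+ 3 +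
    \int[P]_x `|S 0 x| ^+ 3) m0 beta0 beta5 bN hrec Dlim a0) => j j0.
  have LT := L3_tail P zeta r S a c b mz ind L3z z2 adr L3r mS cvgS eqr 0 j.
  apply: le_trans (normr_E3 P _ _ _ (L3r _) (L3r _) LT) _.
  rewrite /Rintegral integral_norm3_stationary// lerD2l.
  exact: (integral_norm3_tail_le P zeta r S a c b mz ind L3z z1 z2 adr L3r mS cvgS eqr).
split=> -[ab1 abj] t j j0 jk; rewrite covE// lte_fin.
  have [m0 Dlt] := key (ltr0_neq0 ab1).
  exact: (recursion_sign b h D a m k m0 Dlt hrec ab1 abj).
have [m0 Dlt] := key (lt0r_neq0 ab1).
(* The recursion is invariant under (b, h) -> (-b, -h) with D kept fixed, since b enters the
   convolution only through its square. This turns the positive case into the negative one. *)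
rewrite -oppr_lt0.
apply: (recursion_sign (fun i => - b i) (fun i => - h i) D a m k) => //.
- move=> i i0; rewrite hrec// opprD -sumrN; congr (_ + _); first by ring.
  by apply: eq_bigr => l _; rewrite sqrrN mulrN.
- by rewrite mulrN oppr_lt0.
- by move=> i i2 ik; rewrite mulrN oppr_le0 abj.
Qed.
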